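(* For all constants $c,C>0$ there exists a constant $a>0$, depending only on $c$ and $C$, such that for every $\varepsilon\ge0$ and all integers $S\ge2$, $n\ge2$ with $n\ge c\,\frac{e^\varepsilon S}{\ln S}$ and $\ln n\le C\ln S$, $$\sup_{P\in\mathcal{M}_S}\;\inf_{\widehat d_\varepsilon(P\|Q_n)}\;\sup_{Q\in\mathcal{M}_S}\mathbb{E}_Q\Big[\big|\widehat d_\varepsilon(P\|Q_n)-d_\varepsilon(P\|Q)\big|^2\Big]\;\ge\;a\,\frac{e^\varepsilon S}{n\ln n},$$ where the infimum is over all estimators, i.e. all (measurable) real-valued functions of $Q_n$, which may depend on the known quantities $P,\varepsilon,n,S$.
   Context: $\mathcal{M}_S$ is the set of probability distributions on $[S]=\{1,\dots,S\}$; $[x]^+=\max\{x,0\}$; $d_\varepsilon(P\|Q)=\sum_{i=1}^S[p_i-e^\varepsilon q_i]^+$. Sampling model (Poisson sampling, expected sample size $n$): $Q_n=(\hat q_1,\dots,\hat q_S)$ with $\hat q_1,\dots,\hat q_S$ independent and $n\hat q_i\sim\mathrm{Poi}(nq_i)$ (the counts of $N\sim\mathrm{Poi}(n)$ i.i.d. samples from $Q$, divided by $n$). $\mathbb{E}_Q$ is expectation over $Q_n$. *)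

(* Defs.v *)
(* MathComp-Analysis *)
From HB Require Import structures.
From mathcomp Require Import all_boot all_order all_algebra.
From mathcomp Require Import all_classical all_reals all_analysis.

Set Implicit Arguments.
Unset Strict Implicit.
Unset Printing Implicit Defensive.

Import Order.TTheory GRing.Theory Num.Theory.
Import numFieldNormedType.Exports.

Local Open Scope classical_set_scope.
Local Open Scope ring_scope.

Section product_of_probabilities.
Context d (T : measurableType d) (R : realType).
Local Open Scope ereal_scope.

Definition tcons m (z : T * m.-tuple T) : m.+1.-tuple T := [tuple of z.1 :: z.2].

Let measurable_tcons m : measurable_fun [set: T * m.-tuple T] (@tcons m).
Proof. exact: measurable_cons. Qed.

HB.instance Definition _ m :=
  isMeasurableFun.Build _ _ _ _ (@tcons m) (@measurable_tcons m).

(* The joint law, on m-tuples, of independent variables with laws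
   [P ord0], [P 1], ...: the m-fold product measure. *)
Fixpoint prod_prob m : ('I_m -> probability T R) -> probability (m.-tuple T) R :=
  match m with
  | 0 => fun=> \d_([tuple] : 0.-tuple T)
  | m'.+1 => fun P =>
      distribution (P ord0 \x @prod_prob m' (fun i => P (lift ord0 i))) (@tcons m')
  end.

Lemma prod_prob_rect m (P : 'I_m -> probability T R) (B : 'I_m -> set T) :
  (forall i, measurable (B i)) ->
  prod_prob P [set t | forall i, B i (tnth t i)] = \prod_(i < m) P i (B i).
Proof.
elim: m P B => [|m IH] P B mB.
  rewrite big_ord0/= diracE mem_set//; by case.
rewrite big_ord_recl -(IH (fun i => P (lift ord0 i)) (fun i => B (lift ord0 i)))//.
rewrite /= /distribution /pushforward -product_measure1E//; last first.
  rewrite [X in measurable X](_ : _ = \bigcap_(i in [set: 'I_m])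
      ((fun t : m.-tuple T => tnth t i) @^-1` B (lift ord0 i))); last first.
    by apply/seteqP; split => t /= h i; [move=> _|]; exact: h.
  apply: fin_bigcap_measurable => // i _.
  by rewrite -[X in measurable X]setTI; exact: measurable_tnth.
congr (_ _); apply/seteqP; split => [[x t] /= h|[x t] /= [h0 h] i].
- split; first by have := h ord0.
  by move=> i; have := h (lift ord0 i); rewrite tnthS.
- by have [j ->|->//] := unliftP ord0 i; rewrite tnthS.
Qed.

End product_of_probabilities.

(* Elements of [simplex R S] are the probability distributions on [S], with
   [S] represented by ['I_S]. *)
Definition simplex (R : realType) (S : nat) : set ('I_S -> R) :=
  [set p | (forall i, 0 <= p i) /\ \sum_(i < S) p i = 1].

Definition eps_div (R : realType) (S : nat) (eps : R) (p q : 'I_S -> R) : R :=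
  \sum_(i < S) Num.max (p i - expR eps * q i) 0.

(* Joint law of the counts (n \hat q_1, ..., n \hat q_S). The last argument
   of [poisson_prob] is a dummy. *)
Definition poisson_counts (R : realType) (S n : nat) (q : 'I_S -> R) :
    probability (S.-tuple nat) R :=
  prod_prob (fun i => poisson_prob (n%:R * q i) 0%N).

Definition empirical (R : realType) (S n : nat) (k : S.-tuple nat) :
    S.-tuple R :=
  [tuple (tnth k i)%:R / n%:R | i < S].

Definition mse (R : realType) (S n : nat) (eps : R) (p : 'I_S -> R)
    (dhat : S.-tuple R -> R) (q : 'I_S -> R) : \bar R :=
  'E_(poisson_counts n q)
    [fun k => `|dhat (empirical R n k) - eps_div eps p q| ^+ 2].

(* sup over P, inf over measurable estimators, sup over Q; P, eps, n, S are
   fixed before the estimator is chosen. *)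
Definition minimax_risk (R : realType) (S n : nat) (eps : R) : \bar R :=
  ereal_sup [set
    ereal_inf [set
      ereal_sup [set mse n eps p dhat q | q in @simplex R S]
    | dhat in [set f : S.-tuple R -> R | measurable_fun setT f]]
  | p in @simplex R S].

(* Main.v *)
(* Choose [P] uniform on about [S] symbols, up to one heavy symbol, so that the
   hinge of [q_i |-> max (p_i - e^eps q_i) 0] sits, in terms of the rate n q_i, at
   some lam0 of order n e^-eps / S.  Two priors on the rates, supported on a grid of
   [m - r, m + r] and sharing their moments up to a degree q of order ln S, are
   the positive and negative parts of the signed measure with weights
   E_k / sin^4 (theta_k / 2) at the angles theta_k = pi k / (3 q), where E is
   6-periodic with values 0, 1, -9, 16, -9, 1.  The decay of order 4 keeps the
   mean of the rates of order lam0, so that the total mass stays below one with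
   overwhelming probability, and a convexity argument shows that the two priors
   separate the mean of the hinge by about sqrt (lam0 ln S) / q.

   Exchanging the two priors one symbol at a time changes the law of the counts
   by a polynomially small amount: the leftover mass of [Q] sits on a symbol not
   charged by [P], and the chi-square distance of the resulting mixtures of pairs
   of Poisson laws only involves moments of degree larger than q.  Hence a clipped
   estimator, being bounded, has nearly the same mean under both product priors,
   while the means of the divergence differ by about sqrt (e^eps S / (n ln n)).
   No control of the fluctuations of the divergence is needed.  When [S] is
   bounded so is [n], and the event that nothing is observed suffices. *)
Require Import Defs.
From mathcomp Require Import all_boot all_order all_algebra.
From mathcomp Require Import all_classical all_reals all_analysis.
From mathcomp Require Import measurable_realfun.
From mathcomp Require Import ring lra zify.

Set Implicit Arguments.
Unset Strict Implicit.
Unset Printing Implicit Defensive.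

Import Order.TTheory GRing.Theory Num.Theory.
Import numFieldNormedType.Exports.

Local Open Scope classical_set_scope.
Local Open Scope ring_scope.

(** * Poisson counts *)

(** Write l for ln S. The obstacle is the low end of the range of n: there lam0 may be as small as a
    constant over l, while the rates must spread over an interval of length of order l for moment
    matching to hide them. Their mean must nevertheless stay of order lam0, since s of them have to
    add up to less than n. So the grid is rotated to put angle 0 exactly on lam0, and the weights
    concentrate there. As 1 - cos theta = 2 sin^2 (theta / 2), weights of order 1 / sin^4 have total
    q^4 but sin^2-moment only q^2, and the mean exceeds lam0 by about l / q^2, that is 1 / l. Decay
    of order 2 would only give l / q, a constant. The fourth power also produces the vanishing
    moments: multiplying weights by -4 sin^2 (theta / 2) takes second differences of their cosine
    moments, so it suffices that E / sin^2 has zero cosine moments up to degree q, which is how E is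
    chosen. *)

Definition pois {R : realType} (x : R) (k : nat) : R :=
  x ^+ k / k`!%:R * expR (- x).

(** At rate 0 the law is a Dirac mass at 0, which [pois] reproduces because 0 ^ 0 = 1; symbols
    without mass do occur below. *)
Lemma poisson_prob_set1 (R : realType) (x : R) (d k : nat) : 0 <= x ->
  poisson_prob x d [set k] = (pois x k)%:E.
Proof.
move=> x0; rewrite /poisson_prob; case: ifPn => [xp|].
  rewrite esum_set1; last by rewrite lee_fin poisson_pmf_ge0.
  by rewrite /poisson_pmf xp.
rewrite -leNgt => x_le0; have -> : x = 0 by apply/le_anti/andP.
rewrite diracE /pois oppr0 expR0 mulr1 expr0n; case: k => [|k].
  by rewrite fact0 divr1 mem_set.
by rewrite mul0r memNset.
Qed.

(** The space is countable and its singletons are finite intersections of preimages. Hence no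
    function of the counts raises a measurability question. *)
Lemma measurable_tuple_nat (S : nat) (A : set (S.-tuple nat)) : measurable A.
Proof.
have m1 (t : S.-tuple nat) : measurable [set t].
  rewrite (_ : [set t] = \bigcap_(i in [set: 'I_S])
      ((fun u : S.-tuple nat => tnth u i) @^-1` [set tnth t i])); last first.
    apply/seteqP; split => [u -> //|u /= h].
    by apply: eq_from_tnth => i; exact: h.
  apply: fin_bigcap_measurable => // i _.
  by rewrite -[X in measurable X]setTI; exact: measurable_tnth.
rewrite (_ : A = \bigcup_k [set t | A t /\ pickle t = k]); last first.
  by apply/seteqP; split => [t At|t [k _ [At _]]//]; exists (pickle t).
apply: bigcup_measurable => k _.
have [[t [At tk]]|no] := pselect (exists t, A t /\ pickle t = k).
  rewrite (_ : [set _ | _] = [set t])//; apply/seteqP; split => [u [_ uk]|u ->//].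
  by apply: (pcan_inj pickleK); rewrite uk tk.
rewrite (_ : [set _ | _] = set0)//; apply/seteqP; split => // u [Au uk].
by apply: no; exists u.
Qed.

Lemma poisson_counts_set1 (R : realType) (S n : nat) (q : 'I_S -> R)
    (t : S.-tuple nat) : (forall i, 0 <= q i) ->
  poisson_counts n q [set t] = (\prod_(i < S) pois (n%:R * q i) (tnth t i))%:E.
Proof.
move=> q0; rewrite (_ : [set t] = [set u | forall i, [set tnth t i] (tnth u i)]).
  rewrite /poisson_counts.
  rewrite (prod_prob_rect (fun i => poisson_prob (n%:R * q i) 0%N)
    (B := fun i => [set tnth t i]))// -prodEFin.
  by apply: eq_bigr => i _; apply: poisson_prob_set1; rewrite mulr_ge0.
by apply/seteqP; split => [u -> //|u /= h]; exact: eq_from_tnth.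
Qed.

(** Keeping finitely many atoms only lowers the integral; from here on the risk enters only through
    finite sums. *)
Lemma mse_ge_sum (R : realType) (S n : nat) (eps : R) (p : 'I_S -> R)
    (dhat : S.-tuple R -> R) (q : 'I_S -> R) (s : seq (S.-tuple nat)) :
  (forall i, 0 <= q i) -> uniq s ->
  ((\sum_(t <- s) (\prod_(i < S) pois (n%:R * q i) (tnth t i)) *
     (dhat (empirical R n t) - eps_div eps p q) ^+ 2)%:E <=
   mse n eps p dhat q)%E.
Proof.
move=> q0 us; rewrite /mse expectation.unlock.
have mf (D : set (S.-tuple nat)) (f : S.-tuple nat -> \bar R) :
    @measurable_fun _ _ (S.-tuple nat) (\bar R) D f.
  by move=> _ Y _; exact: measurable_tuple_nat.
pose f (t : S.-tuple nat) : \bar R :=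
  (`|dhat (empirical R n t) - eps_div eps p q| ^+ 2)%:E.
rewrite -[leRHS]/(\int[poisson_counts n q]_t f t)%E.
have f0 t : (0 <= f t)%E by rewrite lee_fin.
apply: (@le_trans _ _ (\int[poisson_counts n q]_(t in \big[setU/set0]_(t <- s) [set t]) f t)%E); last first.
  by apply: ge0_subset_integral => //; exact: measurable_tuple_nat.
rewrite ge0_integral_bigsetU//; last 2 first.
- by move=> t; exact: measurable_tuple_nat.
- by move=> i j _ _ [x [/= -> ->]].
rewrite -sumEFin; apply: lee_sum => t _.
rewrite (eq_integral (cst (f t))); last by move=> x; rewrite inE => ->.
rewrite integral_cst; last exact: measurable_tuple_nat.
by rewrite [X in (_ * X)%E]poisson_counts_set1// -EFinM lee_fin real_normK ?num_real// mulrC.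
Qed.

(** * An alternating measure on a trigonometric grid *)

Section trig.
Context {R : realType}.
Implicit Types a b x : R.

Lemma cosM2 a b : cos a * cos b = (cos (a + b) + cos (a - b)) / 2.
Proof. by rewrite cosD cosB; field. Qed.

Lemma cos_half x : cos x = 1 - 2 * sin (x / 2) ^+ 2.
Proof.
have -> : x = (x / 2) *+ 2 by rewrite mulr2n; field.
rewrite cos_mulr2n (_ : _ *+ 2 / 2 = x / 2); last by rewrite mulr2n; field.
by rewrite cos2sin2 mulr2n; ring.
Qed.

Lemma sin_half x : sin x = 2 * (sin (x / 2) * cos (x / 2)).
Proof.
have -> : x = (x / 2) *+ 2 by rewrite mulr2n; field.
rewrite sin_mulr2n (_ : _ *+ 2 / 2 = x / 2); last by rewrite mulr2n; field.
by rewrite !mulr2n; ring.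
Qed.

Lemma cos_second_difference b x :
  cos (b + x) - 2 * cos b + cos (b - x) = - 4 * (sin (x / 2) ^+ 2 * cos b).
Proof. by rewrite cosD cosB (cos_half x); ring. Qed.

(** Multiplication by [2 * sin (b / 2)] makes the partial sums telescope. *)
Lemma sum_cos_arith b (n : nat) : sin (b / 2) != 0 -> cos (n%:R * b) = 1 ->
  sin (n%:R * b) = 0 -> \sum_(k < n) cos (k%:R * b) = 0.
Proof.
move=> s0 cn sn.
have H (m : nat) : 2 * sin (b / 2) * (\sum_(k < m) cos (k%:R * b)) =
    sin (m%:R * b - b / 2) + sin (b / 2).
  elim: m => [|m IH]; first by rewrite big_ord0 mul0r sub0r sinN; ring.
  rewrite big_ord_recr/= mulrDr IH.
  rewrite (_ : m.+1%:R * b - b / 2 = m%:R * b + b / 2); last by rewrite -natr1; field.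
  by rewrite sinB sinD; ring.
have := H n; rewrite sinB sn cn => /eqP.
rewrite (_ : 0 * _ - 1 * _ + _ = 0) ?mul0r ?mul1r ?sub0r ?addNr//.
by rewrite !mulf_eq0 (negPf s0) pnatr_eq0/= => /eqP.
Qed.

Lemma cosDnpi2 x (n : nat) : cos (x + n%:R * (2 * pi)) = cos x.
Proof.
have -> : n%:R * (2 * pi) = pi *+ 2 *+ n :> R.
  by rewrite -[in RHS]mulr_natl -[pi *+ 2]mulr_natl.
by rewrite periodicn//; exact: cosD2pi.
Qed.

Lemma sinDnpi2 x (n : nat) : sin (x + n%:R * (2 * pi)) = sin x.
Proof.
have -> : n%:R * (2 * pi) = pi *+ 2 *+ n :> R.
  by rewrite -[in RHS]mulr_natl -[pi *+ 2]mulr_natl.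
by rewrite periodicn//; exact: sinD2pi.
Qed.

Lemma cosNnpi2 x (n : nat) : cos (n%:R * (2 * pi) - x) = cos x.
Proof. by rewrite addrC cosDnpi2 cosN. Qed.

Lemma sinNnpi2 x (n : nat) : sin (n%:R * (2 * pi) - x) = - sin x.
Proof. by rewrite addrC sinDnpi2 sinN. Qed.

Lemma cos_pithird : cos (pi / 3) = 1 / 2 :> R.
Proof.
set x := pi / 3; set c := cos x.
have e3 : pi = x *+ 2 + x :> R by rewrite /x mulr2n; field.
have : cos (x *+ 2 + x) = -1 :> R by rewrite -e3 cospi.
rewrite cosD cos_mulr2n sin_mulr2n -/c => h.
(* The identity cos (3 x) = -1 as a cubic in [c]; its root -1 is then excluded by sin x > 0. *)
have cub : (c + 1) * (2 * c - 1) ^+ 2 = 0.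
  have h2 : (c ^+ 2 *+ 2 - 1) * c - (c * sin x ^+ 2) *+ 2 = -1.
    by rewrite -[RHS]h !mulr2n; ring.
  move: h2; rewrite sin2cos2 -/c !mulr2n => h2.
  have -> : (c + 1) * (2 * c - 1) ^+ 2 =
    ((c ^+ 2 + c ^+ 2 - 1) * c - (c * (1 - c ^+ 2) + c * (1 - c ^+ 2))) + 1 by ring.
  by rewrite h2; ring.
have sx : sin x > 0.
  by apply: sin_gt0_pi; have := @pi_gt0 R; rewrite /x => ?; apply/andP; split; lra.
have := cos2Dsin2 x; rewrite -/c => cs.
move/eqP: cub; rewrite mulf_eq0 sqrf_eq0 => /orP[|] /eqP h1; last by lra.
have c1 : c = -1 by lra.
have : sin x ^+ 2 = 0 by move: cs; rewrite c1 sqrrN expr1n; lra.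
by move/eqP; rewrite sqrf_eq0 gt_eqF.
Qed.

End trig.

Section grid.
Context {R : realType}.
Variable q : nat.
Hypothesis q0 : (0 < q)%N.

Definition grid_angle (k : nat) : R := k%:R * (pi / (3 * q%:R)).
Local Notation th := grid_angle.

Definition grid_sin (k : nat) : R := sin (th k / 2).
Local Notation s := grid_sin.

Let qR : q%:R != 0 :> R. Proof. by rewrite pnatr_eq0 -lt0n. Qed.
Let q0R : 0 < q%:R :> R. Proof. by rewrite ltr0n. Qed.

Lemma grid_period (j : nat) : (6 * q)%N%:R * th j = j%:R * (2 * pi).
Proof. by rewrite /th natrM; field. Qed.

Lemma grid_angleM (j k : nat) : j%:R * th k = k%:R * th j.
Proof. by rewrite /th; ring. Qed.

Lemma grid_angle_rev (k : nat) : (k <= 6 * q)%N -> th (6 * q - k)%N = 2 * pi - th k.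
Proof. by move=> kG; rewrite /th natrB// natrM; field. Qed.

Lemma grid_sin_gt0 (k : nat) : (0 < k < 6 * q)%N -> 0 < s k.
Proof.
move=> /andP[k0 kG]; apply: sin_gt0_pi; have p0 := @pi_gt0 R.
have kR : (0 < k%:R :> R) by rewrite ltr0n.
have kGR : (k%:R < 6 * q%:R :> R) by rewrite -natrM ltr_nat.
have -> : th k / 2 = pi * (k%:R / (6 * q%:R)) by rewrite /th; field.
rewrite mulr_gt0 ?divr_gt0 ?mulr_gt0//=.
by rewrite -[ltRHS]mulr1 ltr_pM2l// ltr_pdivrMr ?mul1r// mulr_gt0.
Qed.

Lemma grid_sin0 : s 0 = 0.
Proof. by rewrite /s /th mul0r mul0r sin0. Qed.

Lemma grid_sin_rev (k : nat) : (k <= 6 * q)%N -> s (6 * q - k)%N = s k.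
Proof.
move=> kG; rewrite /s grid_angle_rev// mulrBl (_ : 2 * pi / 2 = pi); last by field.
by rewrite addrC sinDpi sinN opprK.
Qed.

Lemma sum_cos_grid (j : nat) : (0 < j < 6 * q)%N ->
  \sum_(k < 6 * q) cos (j%:R * th k) = 0.
Proof.
move=> jG; under eq_bigr do rewrite grid_angleM.
have c1 : cos ((6 * q)%N%:R * th j) = 1.
  by rewrite grid_period -[_ * _]add0r cosDnpi2 cos0.
have s1 : sin ((6 * q)%N%:R * th j) = 0.
  by rewrite grid_period -[_ * _]add0r sinDnpi2 sin0.
by apply: sum_cos_arith => //; rewrite gt_eqF// grid_sin_gt0.
Qed.

(* The term [k = 0] vanishes, as [0^-1 = 0]. *)
Definition csc2_sum (j : nat) : R := \sum_(k < 6 * q) cos (j%:R * th k) / s k ^+ 2.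
Local Notation h := csc2_sum.

Let GE : (6 * q = (6 * q).-1.+1)%N. Proof. by rewrite prednK// muln_gt0. Qed.

Lemma sum_grid_nz (f g : nat -> R) : f 0%N = 0 ->
  (forall k, (0 < k < 6 * q)%N -> f k = g k) ->
  \sum_(k < 6 * q) f k = \sum_(k < 6 * q) g k - g 0%N.
Proof.
move=> f0 fg; rewrite GE !big_ord_recl f0 add0r addrAC subrr add0r.
apply: eq_bigr => i _; apply: fg; rewrite lift0/=.
by have := ltn_ord i; lia.
Qed.

(** A second difference in [j] brings out -4 sin^2 (theta_k / 2), which cancels the denominator. The
    remaining cosine sum vanishes except for its missing term at k = 0, whence the 4. *)
Lemma csc2_sum_step (j : nat) : (0 < j < 6 * q)%N ->
  h j.+1 - 2 * h j + h j.-1 = 4.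
Proof.
move=> /[dup] jG /andP[j0 _].
have -> : h j.+1 - 2 * h j + h j.-1 = \sum_(k < 6 * q)
    (cos (j.+1%:R * th k) - 2 * cos (j%:R * th k) + cos (j.-1%:R * th k)) / s k ^+ 2.
  by rewrite mulr_sumr -sumrB -big_split/=; apply: eq_bigr => k _; ring.
pose f (k : nat) := (cos (j.+1%:R * th k) - 2 * cos (j%:R * th k) +
    cos (j.-1%:R * th k)) / s k ^+ 2.
pose g (k : nat) := - 4 * cos (j%:R * th k).
rewrite (@sum_grid_nz f g).
- rewrite -mulr_sumr sum_cos_grid// /g /th mul0r mulr0 cos0; ring.
- by rewrite /f grid_sin0 expr0n invr0 mulr0.
move=> k kG; have sk := grid_sin_gt0 kG.
rewrite /f /g (_ : j.+1%:R * th k = j%:R * th k + th k); last by rewrite -natr1; ring.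
rewrite (_ : j.-1%:R * th k = j%:R * th k - th k); last first.
  by rewrite -[j in RHS]prednK// -[in RHS]natr1; ring.
rewrite cos_second_difference -/(s k); field.
by rewrite gt_eqF.
Qed.

Lemma csc2_sum1 : h 1 = h 0 - 2 * ((6 * q)%N%:R - 1).
Proof.
apply/eqP; rewrite eq_sym subr_eq addrC -subr_eq; apply/eqP.
rewrite /h -sumrB.
pose f (k : nat) := cos (0%:R * th k) / s k ^+ 2 - cos (1%:R * th k) / s k ^+ 2.
rewrite (@sum_grid_nz f (fun=> 2)).
- by rewrite sumr_const card_ord -mulr_natl; ring.
- by rewrite /f grid_sin0 expr0n invr0 !mulr0 subr0.
move=> k kG; have sk := grid_sin_gt0 kG.
rewrite /f mul0r cos0 [1%:R * _]mul1r (cos_half (th k)) -/(s k); field.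
by rewrite gt_eqF.
Qed.

Lemma csc2_sumE (j : nat) : (j <= 6 * q)%N ->
  h j = h 0 - 2 * (6 * q)%N%:R * j%:R + 2 * j%:R ^+ 2.
Proof.
suff H : forall i, (i.+1 <= 6 * q)%N ->
    h i = h 0 - 2 * (6 * q)%N%:R * i%:R + 2 * i%:R ^+ 2 /\
    h i.+1 = h 0 - 2 * (6 * q)%N%:R * i.+1%:R + 2 * i.+1%:R ^+ 2.
  case: j => [_|j jG]; first by rewrite mulr0 subr0 expr0n mulr0 addr0.
  by have [] := H j jG.
elim=> [_|i IH iG].
  by split; [rewrite mulr0 subr0 expr0n mulr0 addr0|rewrite csc2_sum1; ring].
have [h1 h2] := IH (ltnW iG); split=> //.
have iG' : (0 < i.+1 < 6 * q)%N by [].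
have h3 := csc2_sum_step iG'.
have -> : h i.+2 = 4 + 2 * h i.+1 - h i by rewrite -h3/=; ring.
by rewrite h1 h2 -!natr1; ring.
Qed.

(** Summing over [j] first shows that the [h j] add up to 0, while completing the square in
    [csc2_sumE] gives h j >= h 0 - 18 q^2. *)
Lemma csc2_sum0_le : h 0 <= 18 * q%:R ^+ 2.
Proof.
have GR : (6 * q)%N%:R = 6 * q%:R :> R by rewrite natrM.
have tot : \sum_(j < 6 * q) h j = 0.
  rewrite /h exchange_big/= big1// => k _.
  have [k0|k0] := posnP (nat_of_ord k).
    by rewrite big1// => j _; rewrite k0 grid_sin0 expr0n invr0 mulr0.
  rewrite -mulr_suml (_ : \sum_(i < 6 * q) _ = 0) ?mul0r//.
  under eq_bigr do rewrite grid_angleM.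
  by rewrite sum_cos_grid// k0/=.
have : \sum_(j < 6 * q) (h 0 - 18 * q%:R ^+ 2) <= \sum_(j < 6 * q) h j.
  apply: ler_sum => j _; rewrite [leRHS]csc2_sumE; last exact: ltnW (ltn_ord j).
  rewrite GR; have := sqr_ge0 (j%:R - 3 * q%:R : R); nra.
rewrite tot sumr_const card_ord -[leLHS]mulr_natl GR pmulr_rle0 ?mulr_gt0//.
by rewrite subr_le0.
Qed.

Lemma csc2_sum0_ge0 : 0 <= h 0.
Proof. by apply: sumr_ge0 => k _; rewrite mul0r cos0 divr_ge0// sqr_ge0. Qed.

Lemma csc2_le (k : nat) : (k < 6 * q)%N -> 1 / s k ^+ 2 <= h 0.
Proof.
move=> kG; rewrite /h (bigD1 (Ordinal kG))//= mul0r cos0 lerDl.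
by apply: sumr_ge0 => i _; rewrite mul0r cos0 divr_ge0// sqr_ge0.
Qed.

End grid.

(** * Signed weights on the grid with vanishing moments *)

Section weights.
Context {R : realType}.
Variable q : nat.
Hypothesis q0 : (0 < q)%N.
Local Notation th := (@grid_angle R q).
Local Notation s := (@grid_sin R q).
Local Notation h := (@csc2_sum R q).

(* Periodic in [k] with values 0, 1, -9, 16, -9, 1: up to scaling, the only even
   sequence of period 6 vanishing at 0 and orthogonal over a period to the
   constants and to [1 / sin (pi k / 6) ^+ 2]. *)
Definition block_coef (k : nat) : R :=
  - 2 * cos (q%:R * th k) + 8 * cos ((2 * q)%N%:R * th k)
  - 6 * cos ((3 * q)%N%:R * th k).
Local Notation E := block_coef.

Lemma csc2_sumM (i j : nat) : (j <= i)%N ->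
  \sum_(k < 6 * q) cos (i%:R * th k) * cos (j%:R * th k) / s k ^+ 2 =
  (h (i + j) + h (i - j)) / 2.
Proof.
move=> ji; rewrite /csc2_sum -big_split/= mulr_suml; apply: eq_bigr => k _.
by rewrite cosM2 natrD natrB// -mulrDl -mulrBl; ring.
Qed.

(** By [csc2_sumE] the three sums equal h 0 - 12 q i + 2 i^2 + 2 j^2 at i = q, 2 q, 3 q. The
    coefficients -2, 8, -6 add up to 0, which removes h 0 and j^2, and they also annihilate -12 q i
    + 2 i^2. The bound j <= q is what [csc2_sumM] needs at i = q. *)
Lemma csc2_block_sum (j : nat) : (j <= q)%N ->
  \sum_(k < 6 * q) E k * cos (j%:R * th k) / s k ^+ 2 = 0.
Proof.
move=> jq.
have -> : \sum_(k < 6 * q) E k * cos (j%:R * th k) / s k ^+ 2 =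
  - 2 * (\sum_(k < 6 * q) cos (q%:R * th k) * cos (j%:R * th k) / s k ^+ 2) +
  8 * (\sum_(k < 6 * q) cos ((2 * q)%N%:R * th k) * cos (j%:R * th k) / s k ^+ 2) -
  6 * (\sum_(k < 6 * q) cos ((3 * q)%N%:R * th k) * cos (j%:R * th k) / s k ^+ 2).
  by rewrite !mulr_sumr -big_split -sumrB/=; apply: eq_bigr => k _; rewrite /E; ring.
rewrite !csc2_sumM; [|lia..].
rewrite !(csc2_sumE q0 (j := _ + _)%N); [|lia..].
rewrite !(csc2_sumE q0 (j := _ - _)%N); [|lia..].
rewrite !natrD !natrB; [|lia..].
by rewrite !natrM; field.
Qed.

Definition grid_weight (k : nat) : R := E k / s k ^+ 4.
Local Notation W := grid_weight.

Definition grid_moment (j : nat) : R := \sum_(k < 6 * q) W k * cos (j%:R * th k).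
Local Notation g := grid_moment.

Lemma weight_second_difference (j k : nat) : (k < 6 * q)%N ->
  W k * (cos (j%:R * th k + th k) - 2 * cos (j%:R * th k) + cos (j%:R * th k - th k))
  = - 4 * (E k * cos (j%:R * th k) / s k ^+ 2).
Proof.
move=> kG; rewrite cos_second_difference -/(s k) /W.
have [->|k0] := posnP k.
  by rewrite grid_sin0 !expr0n/= invr0 !mulr0 mul0r.
field; rewrite gt_eqF// grid_sin_gt0//; lia.
Qed.

Lemma grid_moment_step (j : nat) : (0 < j <= q)%N -> g j.+1 - 2 * g j + g j.-1 = 0.
Proof.
move=> /andP[j0 jq].
rewrite /g mulr_sumr -sumrB -big_split/=.
rewrite (eq_bigr (fun k : 'I__ => - 4 * (E k * cos (j%:R * th k) / s k ^+ 2))).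
  by rewrite -mulr_sumr csc2_block_sum// mulr0.
move=> k _; rewrite -weight_second_difference//.
rewrite (_ : j.+1%:R * th k = j%:R * th k + th k); last by rewrite -natr1; ring.
rewrite (_ : j.-1%:R * th k = j%:R * th k - th k); first by ring.
by rewrite -[j in RHS]prednK// -[in RHS]natr1; ring.
Qed.

Lemma grid_moment1 : g 1 = g 0.
Proof.
apply/eqP; rewrite -subr_eq0 /g -sumrB.
rewrite (eq_bigr (fun k : 'I__ => - 2 * (E k * cos (0%:R * th k) / s k ^+ 2))).
  by rewrite -mulr_sumr csc2_block_sum// mulr0.
move=> k _; have := weight_second_difference 0 (ltn_ord k).
rewrite [1%:R * _]mul1r !mul0r add0r sub0r cosN => h; lra.
Qed.

Lemma grid_momentE (j : nat) : (j <= q.+1)%N -> g j = g 0.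
Proof.
suff H : forall i, (i <= q)%N -> g i = g 0 /\ g i.+1 = g 0.
  by case: j => [//|j jq]; have [] := H j jq.
elim=> [_|i IH iq]; first by rewrite grid_moment1.
have [h1 h2] := IH (ltnW iq); split=> //.
have := @grid_moment_step i.+1 iq; rewrite /= h1 h2 => h3.
lra.
Qed.

(** The reversal sends 0, ..., 6 q - 1 to 6 q, ..., 1, so the two end values have to agree. *)
Lemma sum_grid_rev (f : nat -> R) : f (6 * q)%N = f 0%N ->
  \sum_(k < 6 * q) f k = \sum_(k < 6 * q) f (6 * q - k)%N.
Proof.
move=> fG; rewrite [RHS](reindex_inj rev_ord_inj)/=.
have -> : \sum_(k < 6 * q) f (6 * q - (6 * q - k.+1))%N = \sum_(k < 6 * q) f k.+1.
  by apply: eq_bigr => k _; congr f; have := ltn_ord k; lia.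
have GE : (6 * q = (6 * q).-1.+1)%N by rewrite prednK// muln_gt0.
move: fG; rewrite GE => fG; rewrite big_ord_recl big_ord_recr/= -GE -fG.
by rewrite [in RHS]addrC -GE; congr (_ + _).
Qed.

Lemma cos_grid_rev (j k : nat) : (k <= 6 * q)%N ->
  cos (j%:R * th (6 * q - k)%N) = cos (j%:R * th k).
Proof. by move=> kG; rewrite grid_angle_rev// mulrBr cosNnpi2. Qed.

Lemma sin_grid_rev (j k : nat) : (k <= 6 * q)%N ->
  sin (j%:R * th (6 * q - k)%N) = - sin (j%:R * th k).
Proof. by move=> kG; rewrite grid_angle_rev// mulrBr sinNnpi2. Qed.

Lemma grid_weight_rev (k : nat) : (k <= 6 * q)%N -> W (6 * q - k)%N = W k.
Proof.
by move=> kG; rewrite /W /E !cos_grid_rev// grid_sin_rev.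
Qed.

Lemma grid_weight_end : W (6 * q)%N = W 0%N.
Proof. by have := grid_weight_rev (leq0n (6 * q)); rewrite subn0. Qed.

Lemma grid_sin_moment (j : nat) : \sum_(k < 6 * q) W k * sin (j%:R * th k) = 0.
Proof.
have : \sum_(k < 6 * q) W k * sin (j%:R * th k) =
    - \sum_(k < 6 * q) W k * sin (j%:R * th k).
  rewrite {1}(sum_grid_rev (f := fun k => W k * sin (j%:R * th k))).
    rewrite -sumrN; apply: eq_bigr => k _.
    by rewrite grid_weight_rev ?sin_grid_rev ?mulrN// ltnW.
  by have := sin_grid_rev j (leq0n (6 * q)); rewrite subn0 grid_weight_end => ->;
    rewrite /grid_angle mul0r mulr0 sin0 oppr0.
by move=> h; lra.
Qed.

(** The subtracted atom cancels the common value of the cosine moments. It sits at the hinge, so it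
    costs nothing in the separation. *)
Definition signed_weight (k : nat) : R := W k - (k == 0)%:R * g 0.
Local Notation v := signed_weight.

Lemma sum_signed_weight (f : nat -> R) :
  \sum_(k < 6 * q) v k * f k = \sum_(k < 6 * q) W k * f k - g 0 * f 0%N.
Proof.
under eq_bigr do rewrite /v mulrBl; rewrite sumrB; congr (_ - _).
have G0 : (0 < 6 * q)%N by rewrite muln_gt0.
rewrite (bigD1 (Ordinal G0))//= big1 ?addr0 ?mul1r// => k.
by rewrite -val_eqE/= => /negPf ->; rewrite !mul0r.
Qed.

Variables A B : R.
(** With r^2 = A^2 + B^2 this is r cos (theta_k + phi): a Chebyshev grid of [-r, r], rotated so that
    index 0 falls on [A]. *)
Definition grid_pt (k : nat) : R := A * cos (th k) - B * sin (th k).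
Local Notation y := grid_pt.

(** Multiplying by y_k shifts the frequency [j] by one either way, so the induction on the power [a]
    carries all frequencies with a + j <= q + 1, for cosine and sine at once. *)
Lemma signed_moments (a j : nat) : (a + j <= q.+1)%N ->
  \sum_(k < 6 * q) v k * (y k ^+ a * cos (j%:R * th k)) = 0 /\
  \sum_(k < 6 * q) v k * (y k ^+ a * sin (j%:R * th k)) = 0.
Proof.
elim: a j => [|a IH] j aj.
  split.
    under eq_bigr do rewrite expr0 mul1r.
    rewrite (sum_signed_weight (fun k => cos (j%:R * th k))).
    rewrite -/(g j) grid_momentE// /grid_angle mul0r mulr0 cos0; ring.
  under eq_bigr do rewrite expr0 mul1r.
  rewrite (sum_signed_weight (fun k => sin (j%:R * th k))) grid_sin_moment.
  by rewrite /grid_angle mul0r mulr0 sin0 mulr0 subr0.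
case: j aj => [|j] aj.
  split; last first.
    by rewrite big1// => k _; rewrite mul0r sin0 !mulr0.
  have [h1 h2] := IH 1 ltac:(lia).
  transitivity (A * (\sum_(k < 6 * q) v k * (y k ^+ a * cos (1%:R * th k))) -
                B * (\sum_(k < 6 * q) v k * (y k ^+ a * sin (1%:R * th k)))).
    rewrite !mulr_sumr -sumrB; apply: eq_bigr => k _.
    by rewrite mul0r cos0 ![1%:R * _]mul1r exprS {1}/y; ring.
  by rewrite h1 h2 !mulr0 subr0.
have [c1 s1] := IH j.+2 ltac:(lia).
have [c0 s0] := IH j ltac:(lia).
split.
  transitivity (A / 2 * (\sum_(k < 6 * q) v k * (y k ^+ a * cos (j.+2%:R * th k))) +
    A / 2 * (\sum_(k < 6 * q) v k * (y k ^+ a * cos (j%:R * th k))) -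
    B / 2 * (\sum_(k < 6 * q) v k * (y k ^+ a * sin (j.+2%:R * th k))) +
    B / 2 * (\sum_(k < 6 * q) v k * (y k ^+ a * sin (j%:R * th k)))).
    rewrite !mulr_sumr -big_split -sumrB -big_split; apply: eq_bigr => k _ /=.
    rewrite (_ : j.+2%:R * th k = j.+1%:R * th k + th k); last by rewrite -natr1; ring.
    rewrite (_ : j%:R * th k = j.+1%:R * th k - th k); last by rewrite -natr1; ring.
    by rewrite exprS {1}/y !(sinB, cosB) !(sinD, cosD); field.
  by rewrite c1 c0 s1 s0 !mulr0 !addr0 subr0.
transitivity (A / 2 * (\sum_(k < 6 * q) v k * (y k ^+ a * sin (j.+2%:R * th k))) +
  A / 2 * (\sum_(k < 6 * q) v k * (y k ^+ a * sin (j%:R * th k))) -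
  B / 2 * (\sum_(k < 6 * q) v k * (y k ^+ a * cos (j%:R * th k))) +
  B / 2 * (\sum_(k < 6 * q) v k * (y k ^+ a * cos (j.+2%:R * th k)))).
  rewrite !mulr_sumr -big_split -sumrB -big_split; apply: eq_bigr => k _ /=.
  rewrite (_ : j.+2%:R * th k = j.+1%:R * th k + th k); last by rewrite -natr1; ring.
  rewrite (_ : j%:R * th k = j.+1%:R * th k - th k); last by rewrite -natr1; ring.
  by rewrite exprS {1}/y !(sinB, cosB) !(sinD, cosD); field.
by rewrite c1 c0 s1 s0 !mulr0 !addr0 subr0.
Qed.

Lemma signed_moment (a : nat) : (a <= q.+1)%N ->
  \sum_(k < 6 * q) v k * y k ^+ a = 0.
Proof.
move=> aq; have [+ _] := @signed_moments a 0 ltac:(lia).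
by under eq_bigr do rewrite mul0r cos0 mulr1.
Qed.

End weights.

(** * Convexity and estimates for cotangents *)

Section cot.
Context {R : realType}.
Implicit Types x w d : R.

Lemma cos_double x : cos (2 * x) = cos x ^+ 2 - sin x ^+ 2.
Proof. by rewrite (_ : 2 * x = x + x) ?cosD; ring. Qed.

Lemma sin_double x : sin (2 * x) = 2 * (sin x * cos x).
Proof. by rewrite (_ : 2 * x = x + x) ?sinD; ring. Qed.

(** By the triangle inequality the right side is at least |cot (w - d) + cot (w + d)| = 2 |sin w cos
    w| / (sin^2 w - sin^2 d), and dropping sin^2 d only lowers this. *)
Lemma abs_cot_convex w d : 0 < sin w -> 0 < sin (w - d) -> 0 < sin (w + d) ->
  2 * (`|cos w| / sin w) <=
  `|cos (w - d)| / sin (w - d) + `|cos (w + d)| / sin (w + d).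
Proof.
move=> s0 p0 r0.
have -> : `|cos (w - d)| / sin (w - d) + `|cos (w + d)| / sin (w + d) =
    (`|cos (w - d) * sin (w + d)| + `|cos (w + d) * sin (w - d)|) /
    (sin (w - d) * sin (w + d)).
  by rewrite !normrM (gtr0_norm p0) (gtr0_norm r0); field; rewrite !gt_eqF.
have pr : sin (w - d) * sin (w + d) = sin w ^+ 2 - sin d ^+ 2.
  have e1 := cos2Dsin2 w; have e2 := cos2Dsin2 d.
  have cw : cos w ^+ 2 = 1 - sin w ^+ 2 by lra.
  have cd : cos d ^+ 2 = 1 - sin d ^+ 2 by lra.
  rewrite sinB sinD.
  transitivity (sin w ^+ 2 * cos d ^+ 2 - cos w ^+ 2 * sin d ^+ 2); first by ring.
  by rewrite cw cd; ring.
rewrite ler_pdivlMr ?mulr_gt0//.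
apply: (@le_trans _ _ `|cos (w - d) * sin (w + d) + cos (w + d) * sin (w - d)|);
  last exact: ler_normD.
have -> : cos (w - d) * sin (w + d) + cos (w + d) * sin (w - d) =
    2 * (cos w * sin w).
  have e2 := cos2Dsin2 d.
  rewrite sinB sinD cosB cosD.
  transitivity (2 * (cos w * sin w * (cos d ^+ 2 + sin d ^+ 2))); first by ring.
  by rewrite e2 mulr1.
rewrite !normrM (gtr0_norm s0) (ger0_norm (ler0n _ 2)).
rewrite -!mulrA ler_pM2l// ler_wpM2l//.
rewrite ler_pdivrMl// pr -expr2 gerBl; exact: sqr_ge0.
Qed.

Lemma sum_block6 (f : nat -> R) (m : nat) : \sum_(k < 6 * m) f k =
  \sum_(i < m) (f (6 * i)%N + f (6 * i).+1 + f (6 * i).+2 + f (6 * i).+3 +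
    f (6 * i).+4 + f (6 * i).+4.+1).
Proof.
elim: m => [|m IH]; first by rewrite muln0 !big_ord0.
rewrite [RHS]big_ord_recr/= -IH (_ : (6 * m.+1 = (6 * m).+4.+2)%N); last lia.
by rewrite 6!big_ord_recr/= !addrA.
Qed.

Definition cot_gap (a b z : R) : R := Num.max a (b * z) * (1 + z ^+ 2).

(** On z >= 0 both a (1 + z^2) and b z (1 + z^2) are convex and nondecreasing, hence so is their
    maximum; monotonicity is what allows an inequality between 2 z and z1 + z2. *)
Lemma cot_gap_convex (a b z z1 z2 : R) : 0 <= a -> 0 <= b -> 0 <= z ->
  0 <= z1 -> 0 <= z2 -> 2 * z <= z1 + z2 ->
  2 * cot_gap a b z <= cot_gap a b z1 + cot_gap a b z2.
Proof.
move=> a0 b0 z0 z10 z20 zz; rewrite /cot_gap.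
have p x : 0 <= 1 + x ^+ 2 :> R by rewrite addr_ge0// sqr_ge0.
have h1 x : a * (1 + x ^+ 2) <= Num.max a (b * x) * (1 + x ^+ 2).
  by rewrite ler_wpM2r// le_max lexx.
have h2 x : b * x * (1 + x ^+ 2) <= Num.max a (b * x) * (1 + x ^+ 2).
  by rewrite ler_wpM2r// le_max lexx orbT.
have sq : 2 * z ^+ 2 <= z1 ^+ 2 + z2 ^+ 2.
  have := sqr_ge0 (z1 - z2); nra.
have [_|_] := leP a (b * z).
  apply: le_trans (lerD (h2 z1) (h2 z2)).
  have cu : 2 * (z * (1 + z ^+ 2)) <= z1 * (1 + z1 ^+ 2) + z2 * (1 + z2 ^+ 2).
    have m0 : z <= (z1 + z2) / 2 by lra.
    have m3 : z ^+ 3 <= ((z1 + z2) / 2) ^+ 3 by rewrite lerXn2r ?nnegrE//; lra.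
    have : 0 <= (z1 + z2) * (z1 - z2) ^+ 2 by rewrite mulr_ge0 ?sqr_ge0 ?addr_ge0.
    move: m3; rewrite !expr2 !exprS expr0; nra.
  by have := ler_wpM2l b0 cu; lra.
apply: le_trans (lerD (h1 z1) (h1 z2)).
by have := ler_wpM2l a0 sq; lra.
Qed.

(** This is k tan x <= tan (k x) cleared of denominators. It turns the values at pi / 6 into a lower
    bound for the cotangent of a small angle. *)
Lemma mul_cot_le x (k : nat) : k%:R * x <= pi / 2 -> 0 <= x ->
  k%:R * (cos (k%:R * x) * sin x) <= sin (k%:R * x) * cos x.
Proof.
move=> + x0; elim: k => [|k IH] kx; first by rewrite !mul0r sin0 mul0r.
have p0 := @pi_gt0 R.
have k1x : (k.+1%:R * x = k%:R * x + x :> R) by rewrite -natr1; ring.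
have kx0 : 0 <= k%:R * x by rewrite mulr_ge0.
have kle : k%:R * x <= pi / 2 by rewrite k1x in kx; lra.
have xle : x <= pi / 2 by rewrite k1x in kx; lra.
have := IH kle; rewrite k1x sinD cosD -natr1.
set C := cos (k%:R * x); set S := sin (k%:R * x); set c := cos x; set t := sin x.
move=> h.
have c0 : 0 <= c by apply: cos_ge0_pihalf; apply/andP; split; lra.
have t0 : 0 <= t by apply: sin_ge0_pi; apply/andP; split; lra.
have S0 : 0 <= S by apply: sin_ge0_pi; apply/andP; split; lra.
have h1 : 0 <= c * (S * c - k%:R * (C * t)) by rewrite mulr_ge0// subr_ge0.
have h2 : 0 <= (k%:R + 1) * (S * t ^+ 2) by rewrite !mulr_ge0// ?addr_ge0// exprn_ge0.
rewrite -subr_ge0.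
have -> : (S * c + C * t) * c - (k%:R + 1) * ((C * c - S * t) * t) =
   c * (S * c - k%:R * (C * t)) + (k%:R + 1) * (S * t ^+ 2) by ring.
exact: addr_ge0.
Qed.

(* The leading coefficient is [1 - 9/2^3 + 15/3^3 - 7/4^3 - 7/(4 * 8^2)]. *)
Lemma first_block_ge (c z2 z3 z4 z8 : R) : 7 <= c -> 0 <= z2 <= c / 2 ->
  c / 3 - 1 / c <= z3 -> 0 <= z4 <= c / 4 -> 0 <= z8 <= c / 8 ->
  c ^+ 3 / 10 <= c * (1 + c ^+ 2) - 9 * (z2 * (1 + z2 ^+ 2)) +
    15 * (z3 * (1 + z3 ^+ 2)) - 7 * (z4 * (1 + z4 ^+ 2)) - 7 * (z4 * (1 + z8 ^+ 2)).
Proof.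
move=> c7 /andP[z20 z2c] z3c /andP[z40 z4c] /andP[z80 z8c].
have c0 : 0 < c by lra.
have sq x y : 0 <= x -> x <= y -> 1 + x ^+ 2 <= 1 + y ^+ 2 :> R.
  by move=> x0 xy; rewrite lerD2l lerXn2r// nnegrE// (le_trans x0).
have p x : 0 <= 1 + x ^+ 2 :> R by rewrite addr_ge0// sqr_ge0.
have b2 : z2 * (1 + z2 ^+ 2) <= c / 2 * (1 + (c / 2) ^+ 2).
  by apply: ler_pM => //; exact: sq.
have b4 : z4 * (1 + z4 ^+ 2) <= c / 4 * (1 + (c / 4) ^+ 2).
  by apply: ler_pM => //; exact: sq.
have b8 : z4 * (1 + z8 ^+ 2) <= c / 4 * (1 + (c / 8) ^+ 2).
  by apply: ler_pM => //; exact: sq.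
pose t := 1 / c; have ct : c * t = 1 by rewrite /t mul1r divff// gt_eqF.
have t0 : 0 <= t by rewrite divr_ge0// ltW.
have t7 : t <= 1 / 7.
  by rewrite /t !div1r lef_pV2 ?posrE//; lra.
have w0 : 0 <= c / 3 - t by lra.
have b3 : (c / 3 - t) * (1 + (c / 3 - t) ^+ 2) <= z3 * (1 + z3 ^+ 2).
  by apply: ler_pM => //; exact: sq.
have e3 : (c / 3 - t) * (1 + (c / 3 - t) ^+ 2) = c ^+ 3 / 27 - t ^+ 3.
  transitivity (c / 3 - t + c ^+ 3 / 27 - c * (c * t) / 3 + (c * t) * t - t ^+ 3).
    by field.
  by rewrite ct; field.
have t3 : t ^+ 3 <= 1.
  by rewrite exprn_ile1//; lra.
(* This lets c^3 absorb the lower-order terms. *)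
have c3 : 49 * c <= c ^+ 3.
  rewrite exprS mulrC ler_pM2l//; rewrite expr2; nra.
have e2 : c / 2 * (1 + (c / 2) ^+ 2) = c / 2 + c ^+ 3 / 8 by field.
have e4 : c / 4 * (1 + (c / 4) ^+ 2) = c / 4 + c ^+ 3 / 64 by field.
have e8 : c / 4 * (1 + (c / 8) ^+ 2) = c / 4 + c ^+ 3 / 256 by field.
have e1 : c * (1 + c ^+ 2) = c + c ^+ 3 by ring.
rewrite e2 in b2; rewrite e4 in b4; rewrite e8 in b8; rewrite e3 in b3; rewrite e1.
lra.
Qed.

End cot.

(** * Separation of the hinge *)

Section gap.
Context {R : realType}.
Variable q : nat.
Hypothesis q7 : (7 <= q)%N.
Let q0 : (0 < q)%N. Proof. exact: leq_trans q7. Qed.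
Let q0R : 0 < q%:R :> R. Proof. by rewrite ltr0n. Qed.
Let qR : q%:R != 0 :> R. Proof. by rewrite gt_eqF. Qed.
Local Notation th := (@grid_angle R q).
Local Notation s := (@grid_sin R q).
Local Notation h := (@csc2_sum R q).
Local Notation E := (@block_coef R q).
Local Notation W := (@grid_weight R q).
Local Notation v := (@signed_weight R q).

Lemma abs_block_coef k : `|E k| <= 16.
Proof.
have b n := @cos_geN1 R (n%:R * th k); have b' n := @cos_le1 R (n%:R * th k).
rewrite /block_coef; have := b q; have := b' q.
have := b (2 * q)%N; have := b' (2 * q)%N.
have := b (3 * q)%N; have := b' (3 * q)%N => *.
by rewrite ler_norml; apply/andP; split; lra.
Qed.

(** Since q theta_k = k pi / 3 is free of q, the coefficient is a polynomial in cos (k pi / 3), from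
    which period and values follow. *)
Lemma block_coefE k (x := cos (k%:R * (pi / 3))) :
  E k = - 24 * x ^+ 3 + 16 * x ^+ 2 + 16 * x - 8.
Proof.
rewrite /block_coef.
have e n : (n * q)%N%:R * th k = n%:R * (k%:R * (pi / 3)).
  by rewrite /grid_angle natrM; field.
have := e 1%N; rewrite mul1n mul1r => ->; rewrite !e.
have -> : 3 * (k%:R * (pi / 3)) = 2 * (k%:R * (pi / 3)) + k%:R * (pi / 3) :> R by ring.
rewrite cosD sin_double cos_double -/x.
transitivity (- 2 * x + 8 * (x ^+ 2 - sin (k%:R * (pi / 3)) ^+ 2) -
  6 * ((x ^+ 2 - sin (k%:R * (pi / 3)) ^+ 2) * x
   - 2 * x * sin (k%:R * (pi / 3)) ^+ 2)); first by ring.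
by rewrite sin2cos2 -/x; ring.
Qed.

Lemma block_coef_period i l : E (6 * i + l)%N = E l.
Proof.
rewrite !block_coefE.
have -> : cos ((6 * i + l)%N%:R * (pi / 3)) = cos (l%:R * (pi / 3)) :> R.
  rewrite -(cosDnpi2 (l%:R * (pi / 3)) i); congr cos.
  by rewrite natrD natrM; field.
by [].
Qed.

Lemma block_coef_values :
  [/\ E 0 = 0, E 1 = 1, E 2 = -9, E 3 = 16 & E 4 = -9 /\ E 5 = 1].
Proof.
have c1 : cos (1%:R * (pi / 3)) = 1 / 2 :> R.
  by rewrite [1%:R * _]mul1r cos_pithird.
have c2 : cos (2%:R * (pi / 3)) = - (1 / 2) :> R.
  by rewrite cos_double sin2cos2 cos_pithird; field.
have c4 : cos (4%:R * (pi / 3)) = - (1 / 2) :> R.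
  rewrite -c2 -(cosNnpi2 (2 * (pi / 3)) 1); congr cos; by field.
have c5 : cos (5%:R * (pi / 3)) = 1 / 2 :> R.
  rewrite -c1 -(cosNnpi2 (1 * (pi / 3)) 1); congr cos; by field.
have c3 : cos (3%:R * (pi / 3)) = -1 :> R.
  by rewrite -cospi; congr cos; by field.
rewrite !block_coefE mul0r cos0 c1 c2 c3 c4 c5.
by split; [| | | |split]; field.
Qed.

Definition grid_cot (k : nat) : R := cos (th k / 2) / s k.
Local Notation z := grid_cot.

Lemma csc2_cot k : 0 < s k -> 1 / s k ^+ 2 = 1 + `|z k| ^+ 2.
Proof.
move=> s0; rewrite real_normK ?num_real// /z.
have cs : cos (th k / 2) ^+ 2 = 1 - s k ^+ 2 by rewrite -cos2sin2.
by rewrite expr_div_n cs; field; rewrite gt_eqF.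
Qed.

Lemma grid_cot_convex k : (1 <= k)%N -> (k.+2 < 6 * q)%N ->
  2 * `|z k.+1| <= `|z k| + `|z k.+2|.
Proof.
move=> k1 kG; pose d := th 1 / 2.
have s1 : 0 < s k.+1 by apply: grid_sin_gt0; lia.
have s0 : 0 < s k by apply: grid_sin_gt0; lia.
have s2 : 0 < s k.+2 by apply: grid_sin_gt0; lia.
have e0 : th k / 2 = th k.+1 / 2 - d by rewrite /d /grid_angle -natr1; field.
have e2 : th k.+2 / 2 = th k.+1 / 2 + d by rewrite /d /grid_angle -!natr1; field.
have := @abs_cot_convex R (th k.+1 / 2) d.
rewrite -e0 -e2 -!/(s _) => /(_ s1 s0 s2).
by rewrite /z !normrM !normfV !(gtr0_norm s0) !(gtr0_norm s1) !(gtr0_norm s2).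
Qed.

Lemma grid_cot_rev k : (k <= 6 * q)%N -> `|z (6 * q - k)| = `|z k|.
Proof.
move=> kG; rewrite /z grid_sin_rev// grid_angle_rev// mulrBl.
rewrite (_ : 2 * pi / 2 = pi); last by field.
by rewrite addrC cosDpi cosN mulNr normrN.
Qed.

Variables A B : R.
Hypothesis B0 : 0 <= B.
Local Notation y := (grid_pt q A B).

Definition grid_gap k := cot_gap `|A| B `|z k|.
Local Notation Y := grid_gap.

Lemma grid_gap_ge0 k : 0 <= Y k.
Proof.
apply: mulr_ge0; first by rewrite le_max normr_ge0.
by rewrite addr_ge0// sqr_ge0.
Qed.

Lemma grid_gap_convex k : (1 <= k)%N -> (k.+2 < 6 * q)%N ->
  2 * Y k.+1 <= Y k + Y k.+2.
Proof.
move=> k1 kG; apply: cot_gap_convex => //.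
exact: grid_cot_convex.
Qed.

Lemma abs_sum_diff (a b : R) : `|a + b| + `|a - b| = 2 * Num.max `|a| `|b|.
Proof.
wlog : a b / 0 <= a => [H|a0].
  have [a0|a0] := leP 0 a; first exact: H.
  have a1 : 0 <= - a by lra.
  have := H _ (- b) a1.
  have -> : - a + - b = - (a + b) by ring.
  have -> : - a - - b = - (a - b) by ring.
  by rewrite !normrN.
wlog : b / 0 <= b => [H|b0].
  have [b0|b0] := leP 0 b; first exact: H.
  have b1 : 0 <= - b by lra.
  by have := H _ b1; rewrite opprK normrN addrC => ->.
rewrite (ger0_norm a0) (ger0_norm b0) ger0_norm ?addr_ge0//.
by case: (leP a b) => ab; [rewrite ler0_norm|rewrite ger0_norm]; lra.
Qed.

(** By the half-angle formulas y - A is -2 A s^2 - 2 B s c at k and -2 A s^2 + 2 B s c at the mirror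
    index. The two absolute values add up to a maximum with 4 s^2 in front, which reduces the weight
    1 / s^4 to 1 / s^2 = 1 + z^2. *)
Lemma weight_gap k : (k < 6 * q)%N ->
  W k * (`|y k - A| + `|y (6 * q - k)%N - A|) = 4 * (E k * Y k).
Proof.
move=> kG; have [k0|k0] := posnP k.
  have [E0 _ _ _ _] := block_coef_values.
  by rewrite k0 /grid_weight E0; ring.
have s0 : 0 < s k by apply: grid_sin_gt0; lia.
set c := cos (th k / 2).
have yA : y k - A = - 2 * A * s k ^+ 2 - 2 * B * (s k * c).
  by rewrite /grid_pt (cos_half (th k)) (sin_half (th k)) -/(s k) -/c; ring.
have yA' : y (6 * q - k)%N - A = - 2 * A * s k ^+ 2 + 2 * B * (s k * c).
  rewrite /grid_pt grid_angle_rev// ?(ltnW kG)//.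
  have := cosNnpi2 (th k) 1; have := sinNnpi2 (th k) 1; rewrite !mul1r => -> ->.
  by rewrite (cos_half (th k)) (sin_half (th k)) -/(s k) -/c; ring.
have n1 : `|- 2 * A * s k ^+ 2| = 2 * s k ^+ 2 * `|A|.
  rewrite (_ : - 2 * A * s k ^+ 2 = - (2 * s k ^+ 2 * A)); last by ring.
  by rewrite normrN normrM ger0_norm// mulr_ge0// sqr_ge0.
have n2 : `|2 * B * (s k * c)| = 2 * s k ^+ 2 * (B * (`|c| / s k)).
  rewrite (_ : 2 * B * (s k * c) = 2 * B * s k * c); last by ring.
  rewrite normrM ger0_norm; first by field; rewrite gt_eqF.
  by rewrite !mulr_ge0// ltW.
rewrite yA yA' addrC abs_sum_diff n1 n2.
rewrite /grid_gap /cot_gap -csc2_cot// /z normrM normfV (gtr0_norm s0) -/c.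
rewrite -maxr_pMr; last by rewrite mulr_ge0// sqr_ge0.
by rewrite /grid_weight; field; rewrite gt_eqF.
Qed.

(** The hinge is half of |y - A| - (y - A), and the linear part is killed by the moments 0 and 1.
    The atom at index 0 drops out because y 0 = A. *)
Lemma sum_weight_gap :
  \sum_(k < 6 * q) v k * Num.max (A - y k) 0 = \sum_(k < 6 * q) E k * Y k.
Proof.
have y0 : y 0%N = A by rewrite /grid_pt /grid_angle mul0r cos0 sin0; ring.
have yG : y (6 * q)%N = A.
  have := @grid_angle_rev R q q0 0 (leq0n _); rewrite subn0 /grid_pt => ->.
  rewrite {1 2}/grid_angle mul0r subr0.
  by have := @cosDnpi2 R 0 1; have := @sinDnpi2 R 0 1;
    rewrite !mul1r !add0r => -> ->; rewrite cos0 sin0; ring.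
have m0 := @signed_moment R q q0 A B 0 isT.
have m1 := @signed_moment R q q0 A B 1 isT.
have e1 : \sum_(k < 6 * q) v k * Num.max (A - y k) 0 =
    (\sum_(k < 6 * q) v k * `|y k - A|) / 2.
  apply/eqP; rewrite -subr_eq0; apply/eqP.
  transitivity (A / 2 * (\sum_(k < 6 * q) v k * y k ^+ 0) -
     1 / 2 * (\sum_(k < 6 * q) v k * y k ^+ 1)); last by rewrite m0 m1 !mulr0 subr0.
  rewrite !mulr_sumr mulr_suml -!sumrB; apply: eq_bigr => k _.
  rewrite expr0 expr1; case: (leP (A - y k) 0) => h0.
    by rewrite ger0_norm; [field|lra].
  by rewrite ltr0_norm; [field|lra].
rewrite e1 (sum_signed_weight q0 (fun k => `|y k - A|)) y0 subrr normr0 mulr0 subr0.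
have : 2 * (\sum_(k < 6 * q) W k * `|y k - A|) = 4 * (\sum_(k < 6 * q) E k * Y k).
  rewrite (mulrDl 1 1) mul1r.
  rewrite {2}(sum_grid_rev q0 (f := fun k => W k * `|y k - A|)); last first.
    by rewrite y0 yG subrr normr0 !mulr0.
  rewrite -big_split/= mulr_sumr; apply: eq_bigr => k _.
  by rewrite grid_weight_rev// ?(ltnW (ltn_ord k))// -mulrDr weight_gap.
by move=> e; lra.
Qed.

End gap.

Section gap_bound.
Context {R : realType}.
Variable q : nat.
Hypothesis q7 : (7 <= q)%N.
Let q0 : (0 < q)%N. Proof. exact: leq_trans q7. Qed.
Let q0R : 0 < q%:R :> R. Proof. by rewrite ltr0n. Qed.
Let qR : q%:R != 0 :> R. Proof. by rewrite gt_eqF. Qed.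
Local Notation th := (@grid_angle R q).
Local Notation s := (@grid_sin R q).
Local Notation h := (@csc2_sum R q).
Local Notation E := (@block_coef R q).
Local Notation W := (@grid_weight R q).
Local Notation v := (@signed_weight R q).
Local Notation z := (@grid_cot R q).

Lemma grid_cot_double k l : (0 < k)%N -> (4 * k < 6 * q)%N -> l = (2 * k)%N ->
  z l = (z k ^+ 2 - 1) / (2 * z k) /\ 0 < z k.
Proof.
move=> k0 kG ->; have s0 : 0 < s k by apply: grid_sin_gt0; lia.
have e : th (2 * k)%N / 2 = 2 * (th k / 2).
  by rewrite /grid_angle natrM; field.
have p0 := @pi_gt0 R.
have c0 : 0 < cos (th k / 2).
  have k0R : 0 < k%:R :> R by rewrite ltr0n.
  have kGR : 4 * k%:R < 6 * q%:R :> R by rewrite -!natrM ltr_nat.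
  have te : th k / 2 = pi / 2 * (k%:R / (3 * q%:R)) by rewrite /grid_angle; field.
  have t0 : 0 <= th k / 2.
    by rewrite te mulr_ge0// divr_ge0 ?mulr_ge0// ltW.
  apply: cos_gt0_pihalf; apply/andP; split; first lra.
  rewrite te -[ltRHS]mulr1 ltr_pM2l; last lra.
  by rewrite ltr_pdivrMr; lra.
split; last by rewrite /grid_cot divr_gt0.
rewrite /grid_cot /grid_sin e cos_double sin_double -/(s k).
by field; rewrite !gt_eqF.
Qed.

Lemma grid_cot_triple : z 3 = (z 1 ^+ 3 - 3 * z 1) / (3 * z 1 ^+ 2 - 1).
Proof.
have s1 : 0 < s 1 by apply: grid_sin_gt0; lia.
have s3 : 0 < s 3 by apply: grid_sin_gt0; lia.
have e : th 3 / 2 = 2 * (th 1 / 2) + th 1 / 2 by rewrite /grid_angle; field.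
have s3e : s 3 = s 1 * (3 * cos (th 1 / 2) ^+ 2 - s 1 ^+ 2).
  by rewrite {1}/grid_sin e sinD sin_double cos_double -/(s 1); ring.
have d0 : 0 < 3 * cos (th 1 / 2) ^+ 2 - s 1 ^+ 2.
  by move: s3; rewrite s3e pmulr_rgt0.
rewrite {1}/grid_cot s3e e cosD sin_double cos_double -/(s 1) /grid_cot.
field; rewrite !gt_eqF//=.
by rewrite mulN1r.
Qed.

(** [mul_cot_le] with factor q, as q theta_1 / 2 = pi / 6 and cot (pi / 6) >= 1. *)
Lemma grid_cot1_ge : q%:R <= z 1.
Proof.
have s1 : 0 < s 1 by apply: grid_sin_gt0; lia.
have p0 := @pi_gt0 R.
have e : q%:R * (th 1 / 2) = pi / 3 / 2 by rewrite /grid_angle; field.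
have t0 : 0 <= th 1 / 2.
  by rewrite /grid_angle !divr_ge0// mulr_ge0// divr_ge0 ?mulr_ge0// ltW.
have h0 : q%:R * (th 1 / 2) <= pi / 2 by rewrite e; lra.
have := mul_cot_le h0 t0; rewrite e -/(s 1).
have hs := cos_half (pi / 3 : R); rewrite cos_pithird in hs.
have s6 : sin (pi / 3 / 2) ^+ 2 = 1 / 4 :> R by lra.
have c6 : cos (pi / 3 / 2) ^+ 2 = 3 / 4 :> R by rewrite cos2sin2 s6; lra.
have c60 : 0 < cos (pi / 3 / 2) :> R.
  by apply: cos_gt0_pihalf; apply/andP; split; lra.
have s60 : 0 < sin (pi / 3 / 2) :> R by apply: sin_gt0_pi; apply/andP; split; lra.
have sc : sin (pi / 3 / 2) <= cos (pi / 3 / 2) :> R.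
  by rewrite -(@ler_pXn2r _ 2)// ?nnegrE ?(ltW s60) ?(ltW c60)// s6 c6; lra.
rewrite mulrCA => hh.
have c1 : 0 <= cos (th 1 / 2).
  have : 0 <= sin (pi / 3 / 2) * cos (th 1 / 2).
    by apply: le_trans hh; rewrite !mulr_ge0 ?ltW.
  by rewrite pmulr_rge0.
rewrite /grid_cot ler_pdivlMr// -(ler_pM2l c60); apply: (le_trans hh).
by rewrite ler_wpM2r.
Qed.

Let q8 : (4 * 2 < 6 * q)%N. Proof. lia. Qed.

Let q16 : (4 * 4 < 6 * q)%N. Proof. lia. Qed.

Let c : R := z 1.
Let c7 : 7 <= c.
Proof. by apply: le_trans grid_cot1_ge; rewrite ler_nat. Qed.

Lemma small_cots : [/\ 0 < z 2 <= c / 2, c / 3 - 1 / c <= z 3,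
  q%:R / 5 <= z 4 <= c / 4 & 0 <= z 8 <= c / 8].
Proof.
have c0 : 0 < c by have := c7; lra.
have hq : q%:R <= c := grid_cot1_ge.
pose t := 1 / c; have ct : c * t = 1 by rewrite /t mul1r divff// gt_eqF.
have t0 : 0 < t by rewrite divr_gt0.
have t7 : t <= c / 49.
  rewrite /t ler_pdivlMr// mulrAC mul1r ler_pdivrMr//.
  by have := c7; nra.
have [e2 _] := @grid_cot_double 1 2 isT ltac:(lia) erefl.
have [e4 z20] := @grid_cot_double 2 4 isT ltac:(lia) erefl.
have [e8 z40] := @grid_cot_double 4 8 isT ltac:(lia) erefl.
rewrite -/c in e2.
have half (x y : R) : 0 < x -> y = (x ^+ 2 - 1) / (2 * x) -> y = x / 2 - 1 / (2 * x).
  by move=> x0 ->; field; rewrite gt_eqF.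
have inv (x b : R) : 0 < b -> b <= x -> 0 < 1 / (2 * x) <= 1 / (2 * b).
  move=> b0 bx; rewrite !div1r invr_gt0; apply/andP; split; first lra.
  by rewrite lef_pV2 ?posrE//; lra.
have {}e2 := half _ _ c0 e2.
have {}e4 := half _ _ z20 e4.
have {}e8 := half _ _ z40 e8.
have /andP[i2p i2] : 0 < 1 / (2 * c) <= t.
  have -> : 1 / (2 * c) = t / 2 by rewrite /t; field; rewrite gt_eqF.
  by apply/andP; split; lra.
(* Each doubling costs 1 / (2 z), which t <= c / 49 makes small against c: hence 47/100 in place of
   1/2, then 1/5 in place of 1/4. *)
have l2 : 47 / 100 * c <= z 2 by lra.
have /andP[i4p i4] := inv (z 2) (47 / 100 * c) ltac:(lra) l2.
have i4' : 1 / (2 * (47 / 100 * c)) <= 11 / 10 * t.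
  have -> : 1 / (2 * (47 / 100 * c)) = 100 / 94 * t by rewrite /t; field; rewrite gt_eqF.
  lra.
have l4 : c / 5 <= z 4 by lra.
have /andP[i8p i8] := inv (z 4) (c / 5) ltac:(lra) l4.
have i8' : 1 / (2 * (c / 5)) = 5 / 2 * t by rewrite /t; field; rewrite gt_eqF.
split; [rewrite z20/=; lra| |apply/andP; split; lra|apply/andP; split; lra].
rewrite grid_cot_triple -/c -/t.
have d0 : 0 < 3 * c ^+ 2 - 1.
  by have := c7; have := sqr_ge0 (c - 7); rewrite !expr2; nra.
rewrite ler_pdivlMr//.
have -> : (c / 3 - t) * (3 * c ^+ 2 - 1) = c ^+ 3 - c / 3 - 3 * c * (c * t) + t by field.
by rewrite ct; lra.
Qed.

Variables A B : R.
Hypothesis B0 : 0 <= B.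
Hypothesis AB : `|A| <= B * (q%:R / 5).
Local Notation Y := (@grid_gap R q A B).

Lemma grid_gap_rev k : (k <= 6 * q)%N -> Y (6 * q - k)%N = Y k.
Proof. by move=> kG; rewrite /grid_gap grid_cot_rev. Qed.

Let block i := Y (6 * i).+1 - 9 * Y (6 * i).+2 + 16 * Y (6 * i).+3
  - 9 * Y (6 * i).+4 + Y (6 * i).+4.+1.
Let slope k := Y k.+1 - Y k.

Lemma sum_coef_gapE : \sum_(k < 6 * q) E k * Y k = \sum_(i < q) block i.
Proof.
have [E0 E1 E2 E3 [E4 E5]] := @block_coef_values R q q7.
rewrite (sum_block6 (fun k => E k * Y k)); apply: eq_bigr => i _.
have p l := @block_coef_period R q q7 i l.
have := p 0%N; have := p 1%N; have := p 2%N; have := p 3%N; have := p 4%N; have := p 5%N.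
rewrite !addnS addn0 => -> -> -> -> -> ->; rewrite E0 E1 E2 E3 E4 E5 /block.
by ring.
Qed.

Let slope_le i j : (1 <= i)%N -> (i <= j)%N -> (j.+1 < 6 * q)%N -> slope i <= slope j.
Proof.
move=> i1; elim: j => [|j IH]; first by lia.
rewrite leq_eqVlt => /orP[/eqP -> //|ij jG].
apply: le_trans (IH ij (ltnW jG)) _.
have := @grid_gap_convex R q q7 A B B0 j ltac:(lia) jG.
by rewrite /slope; lra.
Qed.

Let block_ge i : (i < q)%N -> - 7 * (slope (6 * i).+3 - slope (6 * i).+2) <= block i.
Proof.
move=> iq.
have := @slope_le (6 * i).+1 (6 * i).+2 isT (leqnSn _) ltac:(lia).
have := @slope_le (6 * i).+3 (6 * i).+4 isT (leqnSn _) ltac:(lia).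
by rewrite /slope /block; lra.
Qed.

(** By convexity the slope at 6 i + 3 is at most the one at 6 (i + 1) + 2, so the bounds of
    [block_ge] over consecutive blocks collapse to the two extreme slopes. *)
Let middle_ge j : (j.+2 < q)%N ->
  - 7 * (slope (6 * j.+1).+3 - slope 8) <= \sum_(i < j.+1) block i.+1.
Proof.
elim: j => [|j IH] jq.
  rewrite big_ord1/=.
  by have := @block_ge 1 ltac:(lia); rewrite muln1.
rewrite big_ord_recr/=.
have := IH ltac:(lia).
have := @block_ge j.+2 ltac:(lia).
have := @slope_le (6 * j.+1).+3 (6 * j.+2).+2 isT ltac:(lia) ltac:(lia).
lra.
Qed.

(* [block_coef] is the second difference of the 6-periodic sequence
   0, 0, 1, -7, 1, 0, so that convexity of [grid_gap] confines the negative
   contributions to the telescoping slopes at the indices 3 mod 6. *)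
Lemma sum_coef_gap_ge :
  2 * (Y 1 - 9 * Y 2 + 15 * Y 3 - 7 * Y 4 - 7 * Y 8) <= \sum_(k < 6 * q) E k * Y k.
Proof.
rewrite sum_coef_gapE.
pose p := (q - 3)%N; have qE : q = p.+3 by rewrite /p; lia.
have -> : \sum_(i < q) block i =
    block 0 + \sum_(i < p.+1) block i.+1 + block p.+2.
  by rewrite [in LHS]qE big_ord_recr big_ord_recl/=.
have rev k l : (k + l = 6 * q)%N -> Y k = Y l.
  by move=> kl; rewrite -(grid_gap_rev (k := l)); [congr Y|]; lia.
have m := @middle_ge p ltac:(lia).
(* As 6 q = 6 p + 18, the indices 6 p + 9 and 6 p + 10 mirror 9 and 8; the middle blocks thus
   contribute at least 14 (Y 9 - Y 8). *)
have e8 : slope (6 * p.+1).+3 = - slope 8.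
  by rewrite /slope (rev _ 8) ?(rev (6 * p.+1).+3 9)//; [ring|lia..].
have b0 : Y 1 - 9 * Y 2 + 15 * Y 3 - 7 * Y 4 <= block 0.
  have := @slope_le 3 4 isT isT ltac:(lia).
  by rewrite /slope /block muln0; lra.
have be : block p.+2 = block 0.
  rewrite /block muln0 (rev (6 * p.+2).+1 5) ?(rev (6 * p.+2).+2 4)
    ?(rev (6 * p.+2).+3 3) ?(rev (6 * p.+2).+4 2) ?(rev (6 * p.+2).+4.+1 1); [ring|lia..].
have := @grid_gap_ge0 R q A B 9.
move: m; rewrite e8 be /slope; lra.
Qed.

(** For k = 1, ..., 4 the hypothesis [AB] decides the maximum and [Y k] is exactly B z (1 + z^2). At
    k = 8 the cotangent may be below q / 5, so the maximum is bounded through z 4 instead. *)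
Lemma gap_ge : B * q%:R ^+ 3 / 5 <=
  \sum_(k < 6 * q) v k * Num.max (A - grid_pt q A B k) 0.
Proof.
rewrite sum_weight_gap//; apply: le_trans sum_coef_gap_ge.
have [/andP[z20 z2c] z3c /andP[z4q z4c] /andP[z80 z8c]] := small_cots.
have c0 : 0 < c by have := c7; lra.
have t7 : 1 / c <= c / 49.
  rewrite ler_pdivlMr// mulrAC mul1r ler_pdivrMr//.
  by have := c7; nra.
have z40 : 0 < z 4 by apply: lt_le_trans z4q; rewrite divr_gt0.
have z24 : z 4 <= z 2.
  have [e4 _] := @grid_cot_double 2 4 isT q8 erefl.
  rewrite e4 ler_pdivrMr; last by rewrite pmulr_rgt0.
  by have := sqr_ge0 (z 2); rewrite expr2; lra.
have z48 : z 8 <= z 4.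
  have [e8 _] := @grid_cot_double 4 8 isT q16 erefl.
  rewrite e8 ler_pdivrMr; last by rewrite pmulr_rgt0.
  by have := sqr_ge0 (z 4); rewrite expr2; lra.
have z34 : z 4 <= z 3 by lra.
have z14 : z 4 <= c by lra.
have Yk k : z 4 <= z k -> Y k = B * (z k * (1 + z k ^+ 2)).
  move=> kz; have zk0 : 0 <= z k by rewrite (le_trans _ kz)// ltW.
  rewrite /grid_gap /cot_gap (ger0_norm zk0) max_r; first by rewrite mulrA.
  by apply: le_trans AB _; rewrite ler_wpM2l// (le_trans z4q).
have Y8 : Y 8 <= B * (z 4 * (1 + z 8 ^+ 2)).
  rewrite /grid_gap /cot_gap (ger0_norm z80) [leRHS]mulrA ler_wpM2r//.
    by rewrite addr_ge0// sqr_ge0.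
  rewrite ge_max; apply/andP; split; last by rewrite ler_wpM2l.
  by apply: le_trans AB _; rewrite ler_wpM2l//.
rewrite (Yk 1%N)// (Yk 2)// (Yk 3)// (Yk 4)// -/c.
have h2 : 0 <= z 2 <= c / 2 by apply/andP; split; [exact: ltW|exact: z2c].
have h4 : 0 <= z 4 <= c / 4 by apply/andP; split; [exact: ltW|exact: z4c].
have h8 : 0 <= z 8 <= c / 8 by apply/andP; split; [exact: z80|exact: z8c].
have fb := first_block_ge c7 h2 z3c h4 h8.
have qc : q%:R ^+ 3 <= c ^+ 3.
  by rewrite lerXn2r ?nnegrE ?ler0n// ?(ltW c0)//; exact: grid_cot1_ge.
have i10 : 0 <= 10^-1 :> R by rewrite invr_ge0.
have := ler_wpM2l B0 (le_trans (ler_wpM2r i10 qc) fb).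
lra.
Qed.

End gap_bound.

(** * The two priors: mass, mean, moments and separation *)

Section prior.
Context {R : realType}.
Variable q : nat.
Hypothesis q7 : (7 <= q)%N.
Let q0 : (0 < q)%N. Proof. exact: leq_trans q7. Qed.
Let q0R : 0 < q%:R :> R. Proof. by rewrite ltr0n. Qed.
Local Notation th := (@grid_angle R q).
Local Notation s := (@grid_sin R q).
Local Notation h := (@csc2_sum R q).
Local Notation W := (@grid_weight R q).
Local Notation v := (@signed_weight R q).

Lemma abs_grid_weight_sin2 k : `|W k| * s k ^+ 2 <= 16 * (1 / s k ^+ 2).
Proof.
have [s0|s0] := eqVneq (s k) 0.
  by rewrite s0 expr0n/= mulr0 mulr_ge0// invr0 mulr0.
rewrite /grid_weight normrM normfV normrX.
have e : `|s k| ^+ 4 = s k ^+ 2 * s k ^+ 2.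
  by rewrite -exprD -normrX ger0_norm// (exprM _ 2 2) sqr_ge0.
rewrite e.
have -> : `|@block_coef R q k| / (s k ^+ 2 * s k ^+ 2) * s k ^+ 2 =
  `|@block_coef R q k| * (1 / s k ^+ 2) by field.
by rewrite ler_wpM2r ?abs_block_coef// divr_ge0// sqr_ge0.
Qed.

Lemma sum_abs_weight_sin2 : \sum_(k < 6 * q) `|W k| * s k ^+ 2 <= 288 * q%:R ^+ 2.
Proof.
apply: (@le_trans _ _ (16 * h 0)); last first.
  by have := @csc2_sum0_le R q q0; lra.
rewrite /csc2_sum mulr_sumr; apply: ler_sum => k _.
by rewrite mul0r cos0 abs_grid_weight_sin2.
Qed.

(** One further factor 1 / sin^2 is at most h 0 <= 18 q^2 by [csc2_le], and 288 * 18 = 72 ^ 2. *)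
Lemma sum_abs_weight : \sum_(k < 6 * q) `|W k| <= 72 ^+ 2 * q%:R ^+ 4.
Proof.
have h18 := @csc2_sum0_le R q q0; have h00 := @csc2_sum0_ge0 R q.
apply: (@le_trans _ _ (\sum_(k < 6 * q) (`|W k| * s k ^+ 2) * h 0)).
  apply: ler_sum => k _.
  have [s0|s0] := eqVneq (s k) 0.
    by rewrite /grid_weight s0 expr0n/= invr0 mulr0 normr0 !mul0r.
  rewrite -mulrA ler_peMr//.
  have := @csc2_le R q k (ltn_ord k).
  by rewrite div1r -[_^-1 <= _]mul1r; rewrite mul1r -ler_pdivrMl ?mulr1 ?exprn_even_gt0// mulr1.
rewrite -mulr_suml.
apply: (@le_trans _ _ (288 * q%:R ^+ 2 * (18 * q%:R ^+ 2))).
  apply: ler_pM => //; last exact: sum_abs_weight_sin2.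
  by apply: sumr_ge0 => k _; rewrite mulr_ge0// sqr_ge0.
by rewrite le_eqVlt; apply/orP; left; apply/eqP; ring.
Qed.

Lemma sum_abs_signed_weight : \sum_(k < 6 * q) `|v k| <= 2 * 72 ^+ 2 * q%:R ^+ 4.
Proof.
have G0 : (0 < 6 * q)%N by rewrite muln_gt0.
apply: (@le_trans _ _ (\sum_(k < 6 * q) (`|W k| +
    (k == 0%N :> nat)%:R * `|@grid_moment R q 0|))).
  apply: ler_sum => k _; rewrite /signed_weight.
  apply: (le_trans (ler_normB _ _)).
  by rewrite lerD2l normrM normr_nat.
rewrite big_split/=.
have -> : \sum_(k < 6 * q) (k == 0%N :> nat)%:R * `|@grid_moment R q 0| =
    `|@grid_moment R q 0|.
  rewrite (bigD1 (Ordinal G0))//= mul1r big1 ?addr0// => k.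
  by rewrite -val_eqE/= => /negPf ->; rewrite mul0r.
have g0 : `|@grid_moment R q 0| <= \sum_(k < 6 * q) `|W k|.
  apply: (le_trans (ler_norm_sum _ _ _)); apply: ler_sum => k _.
  by rewrite mul0r cos0 mulr1.
by have := sum_abs_weight; lra.
Qed.

(** The neighbour of the hinge alone already carries the order q^4 of the total mass. *)
Lemma signed_weight1 : q%:R ^+ 4 <= v 1.
Proof.
have [_ E1 _ _ _] := @block_coef_values R q q7.
have s1 : 0 < s 1 by apply: grid_sin_gt0; lia.
rewrite /signed_weight mul0r subr0 /grid_weight E1.
have -> : 1 / s 1 ^+ 4 = (1 / s 1 ^+ 2) ^+ 2 by field; rewrite gt_eqF.
rewrite csc2_cot// (exprM _ 2 2) lerXn2r ?nnegrE ?sqr_ge0 ?addr_ge0 ?sqr_ge0//.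
apply: (@le_trans _ _ (`|grid_cot q 1| ^+ 2)); last by rewrite lerDr.
rewrite lerXn2r ?nnegrE//.
exact: le_trans (grid_cot1_ge q7) (ler_norm _).
Qed.

Variables A B : R.
Local Notation y := (grid_pt q A B).

(** The sine part cancels by symmetry, and cos theta = 1 - 2 sin^2 (theta / 2) leaves a correction
    of at most 2 |A| * 288 q^2, where 2 * 288 = 24 ^ 2. *)
Lemma sum_grid_pt_le (u : nat -> R) : (forall k, 0 <= u k <= `|v k|) ->
  (forall k, (0 < k < 6 * q)%N -> u (6 * q - k)%N = u k) ->
  \sum_(k < 6 * q) u k * y k <=
  A * (\sum_(k < 6 * q) u k) + `|A| * (24 ^+ 2 * q%:R ^+ 2).
Proof.
move=> u0 usym.
have sin0' : \sum_(k < 6 * q) u k * sin (th k) = 0.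
  have e : \sum_(k < 6 * q) u k * sin (th k) =
      - \sum_(k < 6 * q) u k * sin (th k).
    have G0 : sin (th (6 * q)%N) = 0 :> R.
      have := @sin_grid_rev R q q0 1 0 (leq0n _).
      by rewrite subn0 !mul1r => ->; rewrite /grid_angle mul0r sin0 oppr0.
    rewrite {1}(sum_grid_rev q0 (f := fun k => u k * sin (th k))); last first.
      by rewrite G0 /grid_angle mul0r sin0 !mulr0.
    rewrite -sumrN; apply: eq_bigr => k _.
    have [k0|k0] := posnP k.
      by rewrite k0 subn0 G0 /grid_angle mul0r sin0 !mulr0 oppr0.
    have kG := ltn_ord k.
    rewrite usym ?k0//.
    have := @sin_grid_rev R q q0 1 k (ltnW kG).
    by rewrite !mul1r => ->; rewrite mulrN.
  lra.
have -> : \sum_(k < 6 * q) u k * y k = A * (\sum_(k < 6 * q) u k) -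
    2 * A * (\sum_(k < 6 * q) u k * s k ^+ 2) - B * \sum_(k < 6 * q) u k * sin (th k).
  rewrite !mulr_sumr -!sumrB; apply: eq_bigr => k _.
  by rewrite /grid_pt cos_half -/(s k); ring.
rewrite sin0' mulr0 subr0.
have S0 : 0 <= \sum_(k < 6 * q) u k * s k ^+ 2.
  by apply: sumr_ge0 => k _; have /andP[? _] := u0 k; rewrite mulr_ge0// sqr_ge0.
have S1 : \sum_(k < 6 * q) u k * s k ^+ 2 <= 288 * q%:R ^+ 2.
  apply: le_trans sum_abs_weight_sin2; apply: ler_sum => k _.
  have [k0|k0] := posnP k; first by rewrite k0 grid_sin0 expr0n !mulr0.
  have /andP[_] := u0 k; rewrite /signed_weight (gtn_eqF k0) mul0r subr0 => uk.
  by rewrite ler_wpM2r// sqr_ge0.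
set S := \sum_(k < 6 * q) u k * s k ^+ 2 in S0 S1 *.
have A0 : 0 <= `|A| + A by have := ler_norm (- A); rewrite normrN; lra.
have h1 := ler_wpM2l (normr_ge0 A) S1.
have h2 := mulr_ge0 A0 S0.
lra.
Qed.

Definition prior_mass : R := \sum_(k < 6 * q) Num.max (v k) 0.
Local Notation Z := prior_mass.

Lemma prior_mass_ge : q%:R ^+ 4 <= Z.
Proof.
have G1 : (1 < 6 * q)%N by lia.
rewrite /Z (bigD1 (Ordinal G1))//=; apply: (le_trans signed_weight1).
rewrite -[leLHS]addr0 lerD ?le_max ?lexx//.
by apply: sumr_ge0 => k _; rewrite le_max lexx orbT.
Qed.

Lemma prior_mass_le : Z <= 2 * 72 ^+ 2 * q%:R ^+ 4.
Proof.
apply: le_trans sum_abs_signed_weight; apply: ler_sum => k _.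
by rewrite ge_max ler_norm normr_ge0.
Qed.

Lemma sum_signed_weight0 : \sum_(k < 6 * q) v k = 0.
Proof.
have := @signed_moment R q q0 A B 0 isT.
by under eq_bigr do rewrite expr0 mulr1.
Qed.

Lemma prior_massN : \sum_(k < 6 * q) Num.max (- v k) 0 = Z.
Proof.
apply/eqP; rewrite -subr_eq0 /prior_mass -sumrB; apply/eqP.
transitivity (- \sum_(k < 6 * q) v k); last by rewrite sum_signed_weight0 oppr0.
rewrite -sumrN; apply: eq_bigr => k _.
by case: (leP (v k) 0) => hk; [rewrite max_l|rewrite max_r]; lra.
Qed.

Lemma signed_weight_rev k : (0 < k < 6 * q)%N -> v (6 * q - k)%N = v k.
Proof.
move=> /andP[k0 kG]; rewrite /signed_weight grid_weight_rev ?(ltnW kG)//.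
by rewrite (gtn_eqF k0) subn_eq0 leqNgt kG.
Qed.

Definition prior (b : bool) (k : nat) : R :=
  Num.max ((-1) ^+ b * v k) 0 / Z.

Let Z0 : 0 < Z.
Proof. by apply: lt_le_trans prior_mass_ge; rewrite exprn_gt0. Qed.

Lemma prior_ge0 b k : 0 <= prior b k.
Proof. by rewrite divr_ge0 ?(ltW Z0)// le_max lexx orbT. Qed.

Lemma sum_prior b : \sum_(k < 6 * q) prior b k = 1.
Proof.
rewrite /prior -mulr_suml.
rewrite (_ : \sum_(k < 6 * q) _ = Z) ?divff ?gt_eqF//.
case: b; [rewrite -prior_massN|rewrite /prior_mass]; apply: eq_bigr => k _.
  by rewrite expr1 mulN1r.
by rewrite expr0 mul1r.
Qed.

Lemma priorB k : prior false k - prior true k = v k / Z.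
Proof.
rewrite /prior expr0 expr1 mul1r mulN1r -mulrBl; congr (_ / _).
by case: (leP (v k) 0) => hk; [rewrite max_l|rewrite max_r]; lra.
Qed.

Lemma prior_mean b : \sum_(k < 6 * q) prior b k * y k <=
  A + `|A| * (24 ^+ 2 / q%:R ^+ 2).
Proof.
have -> : \sum_(k < 6 * q) prior b k * y k =
    (\sum_(k < 6 * q) Num.max ((-1) ^+ b * v k) 0 * y k) / Z.
  by rewrite mulr_suml; apply: eq_bigr => k _; rewrite /prior mulrAC.
have sZ : \sum_(k < 6 * q) Num.max ((-1) ^+ b * v k) 0 = Z.
  have := sum_prior b; rewrite /prior -mulr_suml => h1.
  by rewrite -[LHS](divfK (lt0r_neq0 Z0)) h1 mul1r.
rewrite ler_pdivrMr//.
apply: (le_trans (@sum_grid_pt_le (fun k => Num.max ((-1) ^+ b * v k) 0) _ _)).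
- move=> k; rewrite le_max lexx orbT/= ge_max normr_ge0 andbT.
  by apply: le_trans (ler_norm _) _; rewrite normrM normrX normrN1 expr1n mul1r.
- by move=> k kG; rewrite signed_weight_rev.
rewrite sZ [leRHS]mulrDl lerD2l -[leRHS]mulrA ler_wpM2l//.
have -> : 24 ^+ 2 * q%:R ^+ 2 = 24 ^+ 2 / q%:R ^+ 2 * q%:R ^+ 4 :> R.
  by field; rewrite gt_eqF.
by rewrite ler_wpM2l ?prior_mass_ge// divr_ge0// sqr_ge0.
Qed.

Lemma prior_moment a : (a <= q)%N ->
  \sum_(k < 6 * q) (prior false k - prior true k) * y k ^+ a = 0.
Proof.
move=> aq; under eq_bigr do rewrite priorB mulrAC.
by rewrite -mulr_suml signed_moment ?mul0r// (leq_trans aq).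
Qed.

Hypothesis B0 : 0 <= B.
Hypothesis AB : `|A| <= B * (q%:R / 5).

Lemma prior_gap : B / (10 * 72 ^+ 2 * q%:R) <=
  \sum_(k < 6 * q) (prior false k - prior true k) * Num.max (A - y k) 0.
Proof.
under eq_bigr do rewrite priorB mulrAC.
rewrite -mulr_suml ler_pdivlMr//.
apply: le_trans (gap_ge q7 B0 AB).
have b0 : 0 <= B / (10 * 72 ^+ 2 * q%:R) by rewrite divr_ge0// !mulr_ge0// exprn_ge0.
apply: (le_trans (ler_wpM2l b0 prior_mass_le)).
rewrite le_eqVlt; apply/orP; left; apply/eqP; field.
by rewrite gt_eqF.
Qed.

End prior.

(** * Mixtures of Poisson laws with matching moments *)

Section poisson.
Context {R : realType}.
Implicit Types x y m : R.

Lemma cvg_sum_fin (K : finType) (f : K -> nat -> R) (l : K -> R) :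
  (forall k, f k @ \oo --> l k) ->
  (fun n => \sum_k f k n) @ \oo --> \sum_k l k.
Proof.
move=> fl; elim: (index_enum K) => [|k s IH].
  by rewrite big_nil; under eq_fun do rewrite big_nil; exact: cvg_cst.
by rewrite big_cons; under eq_fun do rewrite big_cons; exact: cvgD.
Qed.

Lemma cvg_exp_series x : (fun n => \sum_(k < n) x ^+ k / k`!%:R) @ \oo --> expR x.
Proof.
have : series (exp_coeff x) @ \oo --> expR x by exact: is_cvg_series_exp_coeff.
by rewrite seriesEord.
Qed.

Lemma exp_partial_le x n : 0 <= x -> \sum_(k < n) x ^+ k / k`!%:R <= expR x.
Proof.
move=> x0; have ce := @cvg_exp_series x.
rewrite -(cvg_lim (@Rhausdorff R) ce).
apply: (nondecreasing_cvgn_le (u_ := fun n => \sum_(k < n) x ^+ k / k`!%:R)).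
  apply/nondecreasing_seqP => k; rewrite big_ord_recr/= lerDl.
  by rewrite divr_ge0// exprn_ge0.
exact: cvgP ce.
Qed.

Lemma pois_ge0 x k : 0 <= x -> 0 <= pois x k.
Proof. by move=> x0; rewrite /pois mulr_ge0 ?expR_ge0// divr_ge0// exprn_ge0. Qed.

Lemma sum_poisE x n :
  \sum_(k < n) pois x k = (\sum_(k < n) x ^+ k / k`!%:R) * expR (- x).
Proof. by rewrite mulr_suml. Qed.

Lemma sum_pois_le1 x n : 0 <= x -> \sum_(k < n) pois x k <= 1.
Proof.
move=> x0; rewrite sum_poisE -[leRHS](expRxMexpNx_1 x) ler_wpM2r ?expR_ge0//.
exact: exp_partial_le.
Qed.

Lemma cvg_sum_pois x : (fun n => \sum_(k < n) pois x k) @ \oo --> (1 : R).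
Proof.
rewrite (_ : (fun n => _) =
  (fun n => (\sum_(k < n) x ^+ k / k`!%:R) * expR (- x))); last first.
  by apply/funext => n; exact: sum_poisE.
have := cvgMr_tmp (b := expR (- x)) (@cvg_exp_series x).
by rewrite expRxMexpNx_1; exact.
Qed.

(* Summing over [k] gives the chi-square kernel [expR ((x - m) * (y - m) / m)]
   of Poisson laws, since the remaining factor is again a Poisson law. *)
Lemma pois_ratioM x y m k : 0 < m ->
  pois m k * ((x / m) ^+ k * expR (m - x)) * ((y / m) ^+ k * expR (m - y)) =
  expR ((x - m) * (y - m) / m) * pois (x * y / m) k.
Proof.
move=> m0; rewrite /pois.
have e : expR (- m) * expR (m - x) * expR (m - y) =
    expR ((x - m) * (y - m) / m) * expR (- (x * y / m)).
  by rewrite -!expRD; congr expR; field; rewrite gt_eqF.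
transitivity (((m * (x / m) * (y / m)) ^+ k) / k`!%:R *
   (expR (- m) * expR (m - x) * expR (m - y))); first by rewrite !exprMn; ring.
rewrite e (_ : m * (x / m) * (y / m) = x * y / m); first by ring.
by field; rewrite gt_eqF.
Qed.

Lemma pois_ratio x m k : 0 < m -> pois x k = pois m k * ((x / m) ^+ k * expR (m - x)).
Proof.
move=> m0; rewrite /pois.
have e : expR (- x) = expR (- m) * expR (m - x).
  by rewrite -expRD; congr expR; ring.
have e2 : x ^+ k = m ^+ k * (x / m) ^+ k.
  by rewrite -exprMn; congr (_ ^+ k); field; rewrite gt_eqF.
by rewrite e e2; ring.
Qed.

(** Jensen's inequality, from a nonnegative sum of squares about [mu]. Total mass below one occurs
    because the Poisson laws are truncated. *)
Lemma sqr_wsum_le (T : finType) (w f : T -> R) : (forall t, 0 <= w t) ->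
  \sum_t w t <= 1 -> (\sum_t w t * f t) ^+ 2 <= \sum_t w t * f t ^+ 2.
Proof.
move=> w0 w1; set mu := \sum_t w t * f t.
have h : 0 <= \sum_t w t * (f t - mu) ^+ 2.
  by apply: sumr_ge0 => t _; rewrite mulr_ge0// sqr_ge0.
have e : \sum_t w t * (f t - mu) ^+ 2 =
    \sum_t w t * f t ^+ 2 - 2 * mu * mu + mu ^+ 2 * \sum_t w t.
  rewrite /mu [2 * _ * _]mulr_sumr [X in _ + X]mulr_sumr -sumrB -big_split/=.
  by apply: eq_bigr => t _; rewrite -/mu; ring.
have h2 : mu ^+ 2 * \sum_t w t <= mu ^+ 2 by rewrite ler_piMr// sqr_ge0.
by rewrite e in h; lra.
Qed.

End poisson.

Section moment_matching.
Context {R : realType}.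
Variables (K : finType) (nu d : K -> R) (q : nat) (r ka l : R).
Hypotheses (ka0 : 0 <= ka) (r0 : 0 <= r) (nu2 : \sum_k `|nu k| <= 2).
Hypotheses (dr : forall k, `|d k| <= r) (kar : ka * r ^+ 2 <= 2 * l).
Hypothesis moments : forall j, (j <= q)%N -> \sum_k nu k * d k ^+ j = 0.

Let l0 : 0 <= l.
Proof.
have := le_trans (mulr_ge0 ka0 (sqr_ge0 r)) kar.
by rewrite pmulr_rge0.
Qed.

Let moment_le j : `|\sum_k nu k * d k ^+ j| <= 2 * r ^+ j.
Proof.
apply: (le_trans (ler_norm_sum _ _ _)).
apply: (@le_trans _ _ (\sum_k `|nu k| * r ^+ j)).
  apply: ler_sum => k _; rewrite normrM normrX ler_wpM2l//.
  by rewrite lerXn2r// nnegrE.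
by rewrite -mulr_suml ler_wpM2r// exprn_ge0.
Qed.

Lemma exp_form_moments n :
  \sum_k \sum_k' nu k * nu k' * (\sum_(j < n) (d k * d k' * ka) ^+ j / j`!%:R) =
  \sum_(j < n) ka ^+ j / j`!%:R * (\sum_k nu k * d k ^+ j) ^+ 2.
Proof.
under eq_bigr do under eq_bigr do rewrite mulr_sumr.
under eq_bigr do rewrite exchange_big.
rewrite exchange_big; apply: eq_bigr => j _ /=.
rewrite expr2 big_distrl mulr_sumr; apply: eq_bigr => k _ /=.
rewrite big_distrr mulr_sumr; apply: eq_bigr => k' _ /=.
by rewrite !exprMn; ring.
Qed.

(** Expanding the exponential gives a series of squared moments, whose terms with j <= q vanish. For
    j > q, (2 l)^j = 4^-j (8 l)^j <= 4^-q (8 l)^j, and the series of (8 l)^j / j! is bounded by exp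
    (8 l). *)
Lemma exp_form_le :
  \sum_k \sum_k' nu k * nu k' * expR (d k * d k' * ka) <=
  4 * 4^-1 ^+ q * expR (8 * l).
Proof.
pose u n := \sum_k \sum_k' nu k * nu k' * (\sum_(j < n) (d k * d k' * ka) ^+ j / j`!%:R).
have cu : u @ \oo --> \sum_k \sum_k' nu k * nu k' * expR (d k * d k' * ka).
  apply: cvg_sum_fin => k; apply: cvg_sum_fin => k'.
  by apply: cvgMl_tmp; exact: cvg_exp_series.
apply: (cvgr_to_le cu); apply: nearW => n; rewrite /u exp_form_moments.
apply: (@le_trans _ _ (\sum_(j < n) 4 * 4^-1 ^+ q * ((8 * l) ^+ j / j`!%:R))); last first.
  rewrite -mulr_sumr ler_wpM2l ?mulr_ge0 ?exprn_ge0// exp_partial_le//.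
  by rewrite mulr_ge0// l0.
apply: ler_sum => j _.
have f0 : 0 < (j`!%:R)^-1 :> R by rewrite invr_gt0 ltr0n fact_gt0.
rewrite mulrAC [leRHS]mulrA ler_pM2r//.
have [jq|jq] := leqP j q.
  rewrite moments// expr0n mulr0 mulr_ge0 ?mulr_ge0 ?exprn_ge0//.
  by rewrite mulr_ge0// l0.
have m2 : (\sum_k nu k * d k ^+ j) ^+ 2 <= 4 * (r ^+ 2) ^+ j.
  rewrite -real_normK ?num_real//.
  apply: (@le_trans _ _ ((2 * r ^+ j) ^+ 2)).
    by rewrite lerXn2r// nnegrE ?mulr_ge0// exprn_ge0.
  by rewrite exprMn -!exprM mulnC expr2 -natrM.
apply: (le_trans (ler_wpM2l (exprn_ge0 j ka0) m2)).
have -> : ka ^+ j * (4 * (r ^+ 2) ^+ j) = 4 * (ka * r ^+ 2) ^+ j.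
  by rewrite [(ka * _) ^+ j]exprMn; ring.
rewrite -[leRHS]mulrA ler_pM2l//.
have e : 4^-1 ^+ q * (8 * l) ^+ j = 4 ^+ (j - q) * (2 * l) ^+ j :> R.
  have -> : 8 * l = 4 * (2 * l) by ring.
  rewrite [(4 * _) ^+ j]exprMn -{1}(subnK (ltnW jq)) exprD exprVn; field.
  by rewrite expf_neq0.
rewrite e; apply: (@le_trans _ _ ((2 * l) ^+ j)).
  rewrite lerXn2r// nnegrE; first by rewrite mulr_ge0// sqr_ge0.
  by have := l0; lra.
rewrite ler_peMl//; last by rewrite exprn_ege1// ler1n.
by rewrite exprn_ge0//; have := l0; lra.
Qed.

End moment_matching.

Section box.
Context {R : realType} {I : finType} {b : nat}.
Implicit Types (a : I -> R) (t : {ffun I -> 'I_b}).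

(** Truncating every count below [b] keeps all sums finite; [exists_box] makes the lost mass
    arbitrarily small. *)
Definition pois_box a t : R := \prod_l pois (a l) (t l).

Lemma pois_box_ge0 a t : (forall l, 0 <= a l) -> 0 <= pois_box a t.
Proof. by move=> a0; apply: prodr_ge0 => l _; exact: pois_ge0. Qed.

Lemma sum_pois_box a : \sum_t pois_box a t = \prod_l \sum_(k < b) pois (a l) k.
Proof. by rewrite bigA_distr_bigA. Qed.

Lemma sum_pois_box_le1 a : (forall l, 0 <= a l) -> \sum_t pois_box a t <= 1.
Proof.
move=> a0; rewrite sum_pois_box.
apply: prodr_ile1 => l _; rewrite sum_pois_le1// andbT.
by apply: sumr_ge0 => k _; exact: pois_ge0.
Qed.

Definition rate2 (i j : I) a (x y : R) (l : I) : R :=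
  if l == i then x else if l == j then y else a l.

Lemma prod_rate2 (i j : I) a x y (f : R -> I -> R) : i != j ->
  \prod_l f (rate2 i j a x y l) l =
  f x i * f y j * \prod_(l | (l != i) && (l != j)) f (a l) l.
Proof.
move=> ij; rewrite (bigD1 i)//= (bigD1 j) 1?eq_sym//= mulrA.
rewrite /rate2 !eqxx eq_sym (negPf ij); congr (_ * _).
by apply: eq_bigr => l /andP[/negPf -> /negPf ->].
Qed.

End box.

Section chi2.
Context {R : realType}.
Variables (K : finType) (nu d : K -> R) (q : nat) (r m m2 l : R).
Hypotheses (m0 : 0 < m) (m2m : m <= m2) (r0 : 0 <= r).
Hypotheses (nu2 : \sum_k `|nu k| <= 2).
Hypotheses (dr : forall k, `|d k| <= r) (rl : r ^+ 2 <= m * l).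
Hypothesis moments : forall j, (j <= q)%N -> \sum_k nu k * d k ^+ j = 0.

Let m20 : 0 < m2. Proof. exact: lt_le_trans m2m. Qed.
(** Likelihood ratio of the rates (m + d, m2 - d) to the reference pair (m, m2); the sum of the two
    rates is unchanged because mass only moves between two symbols. *)
Let lr k (u v : nat) : R :=
  ((m + d k) / m) ^+ u * expR (m - (m + d k)) *
  (((m2 - d k) / m2) ^+ v * expR (m2 - (m2 - d k))).

Let ka : R := 1 / m + 1 / m2.
Let x k k' : R := (m + d k) * (m + d k') / m.
Let y k k' : R := (m2 - d k) * (m2 - d k') / m2.

Let lrM k k' u v : pois m u * pois m2 v * lr k u v * lr k' u v =
  expR (d k * d k' * ka) * (pois (x k k') u * pois (y k k') v).
Proof.
have h1 := @pois_ratioM R (m + d k) (m + d k') m u m0.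
have h2 := @pois_ratioM R (m2 - d k) (m2 - d k') m2 v m20.
transitivity ((pois m u * (((m + d k) / m) ^+ u * expR (m - (m + d k))) *
   (((m + d k') / m) ^+ u * expR (m - (m + d k')))) *
   (pois m2 v * (((m2 - d k) / m2) ^+ v * expR (m2 - (m2 - d k))) *
   (((m2 - d k') / m2) ^+ v * expR (m2 - (m2 - d k'))))); first by rewrite /lr; ring.
rewrite h1 h2 -/(x k k') -/(y k k').
rewrite [d k * d k' * ka](_ : _ = (m + d k - m) * (m + d k' - m) / m +
    (m2 - d k - m2) * (m2 - d k' - m2) / m2); last first.
  by rewrite /ka; field; rewrite !gt_eqF.
by rewrite [in RHS]expRD; ring.
Qed.

Let form b : R := \sum_k \sum_k' nu k * nu k' * expR (d k * d k' * ka) *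
   ((\sum_(u < b) pois (x k k') u) * (\sum_(v < b) pois (y k k') v)).

Let formE b : form b =
  \sum_(u < b) \sum_(v < b) pois m u * pois m2 v * (\sum_k nu k * lr k u v) ^+ 2.
Proof.
rewrite /form.
transitivity (\sum_k \sum_k' \sum_(u < b) \sum_(v < b)
   pois m u * pois m2 v * (nu k * lr k u v * (nu k' * lr k' u v))).
  apply: eq_bigr => k _; apply: eq_bigr => k' _.
  rewrite big_distrlr mulr_sumr; apply: eq_bigr => u _ /=.
  rewrite mulr_sumr; apply: eq_bigr => v _ /=.
  transitivity (nu k * nu k' * (pois m u * pois m2 v * lr k u v * lr k' u v)).
    by rewrite lrM; ring.
  by ring.
transitivity (\sum_(u < b) \sum_k \sum_k' \sum_(v < b)
   pois m u * pois m2 v * (nu k * lr k u v * (nu k' * lr k' u v))).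
  by rewrite [RHS]exchange_big/=; apply: eq_bigr => k _; rewrite [LHS]exchange_big.
apply: eq_bigr => u _.
transitivity (\sum_(v < b) \sum_k \sum_k'
   pois m u * pois m2 v * (nu k * lr k u v * (nu k' * lr k' u v))).
  by rewrite [RHS]exchange_big/=; apply: eq_bigr => k _; rewrite [LHS]exchange_big.
apply: eq_bigr => v _; rewrite expr2 big_distrlr mulr_sumr; apply: eq_bigr => k _ /=.
by rewrite mulr_sumr.
Qed.

Let sq_ge0 u v (z : R) : 0 <= pois m u * pois m2 v * z ^+ 2.
Proof.
by apply: mulr_ge0; [apply: mulr_ge0; apply: pois_ge0; exact: ltW|exact: sqr_ge0].
Qed.

Let form_nd : nondecreasing_seq form.
Proof.
apply/nondecreasing_seqP => b; rewrite !formE.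
have p0 u v : 0 <= pois m u * pois m2 v * (\sum_k nu k * lr k u v) ^+ 2.
  exact: sq_ge0.
rewrite [leRHS]big_ord_recr/= -[leLHS]addr0 lerD//; last first.
  by apply: sumr_ge0.
by apply: ler_sum => u _; rewrite [leRHS]big_ord_recr/= lerDl.
Qed.

(** By [formE] the truncated form is a sum of squares, so it increases with [b] to its limit, where
    the Poisson sums have become 1. *)
Let form_le b : form b <= 4 * 4^-1 ^+ q * expR (8 * l).
Proof.
have cf : form @ \oo --> \sum_k \sum_k' nu k * nu k' * expR (d k * d k' * ka).
  apply: cvg_sum_fin => k; apply: cvg_sum_fin => k'.
  rewrite -[X in _ --> X]mulr1; apply: cvgMl_tmp.
  by rewrite -[X in _ --> X]mulr1; apply: cvgM; exact: cvg_sum_pois.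
apply: (@le_trans _ _ (lim (form @ \oo))).
  by apply: nondecreasing_cvgn_le => //; exact: cvgP cf.
rewrite (cvg_lim (@Rhausdorff R) cf).
apply: (@exp_form_le R K nu d q r ka l) => //.
  by rewrite /ka addr_ge0// divr_ge0// ltW.
have k1 : ka <= 2 / m.
  have : 1 / m2 <= 1 / m by rewrite !div1r lef_pV2 ?posrE.
  by rewrite /ka; lra.
apply: (le_trans (ler_wpM2r (sqr_ge0 _) k1)).
apply: (le_trans (ler_wpM2l _ rl)); first by rewrite divr_ge0// ltW.
by rewrite le_eqVlt; apply/orP; left; apply/eqP; field; rewrite gt_eqF.
Qed.

Variables (I : finType) (i j : I) (a : I -> R) (b : nat).
Hypotheses (ij : i != j) (a0 : forall l, 0 <= a l).

(** Change measure to the reference rates and apply [sqr_wsum_le]. The coordinates other than i and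
    j contribute a factor at most 1, and what remains is the chi-square form, bounded by the square
    of the right side. *)
Lemma mixture_box_le (T : {ffun I -> 'I_b} -> R) : (forall t, 0 <= T t <= 1) ->
  `|\sum_k nu k * \sum_t T t * pois_box (rate2 i j a (m + d k) (m2 - d k)) t| <=
  2 * 2^-1 ^+ q * expR (4 * l).
Proof.
move=> T01; pose w t := pois_box (b := b) (rate2 i j a m m2) t.
have r2_ge0 x' y' : 0 <= x' -> 0 <= y' -> forall l', 0 <= rate2 i j a x' y' l'.
  by move=> x0 y0 l'; rewrite /rate2; case: ifP => // _; case: ifP.
have w0 t : 0 <= w t by apply: pois_box_ge0; apply: r2_ge0; exact: ltW.
have w1 : \sum_t w t <= 1 by apply: sum_pois_box_le1; apply: r2_ge0; exact: ltW.
have Wlr k t : pois_box (rate2 i j a (m + d k) (m2 - d k)) t = w t * lr k (t i) (t j).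
  rewrite /w /pois_box !(prod_rate2 a _ _ (fun c l' => pois c (t l')) ij).
  rewrite (pois_ratio (m + d k) (t i) m0) (pois_ratio (m2 - d k) (t j) m20) /lr.
  by ring.
have -> : \sum_k nu k * (\sum_t T t * pois_box (rate2 i j a (m + d k) (m2 - d k)) t) =
    \sum_t w t * (T t * \sum_k nu k * lr k (t i) (t j)).
  under eq_bigr do rewrite mulr_sumr.
  rewrite exchange_big; apply: eq_bigr => t _ /=; rewrite !mulr_sumr.
  by apply: eq_bigr => k _; rewrite Wlr; ring.
have rhs0 : 0 <= 2 * 2^-1 ^+ q * expR (4 * l) :> R.
  by rewrite mulr_ge0 ?expR_ge0// mulr_ge0// exprn_ge0.
rewrite -(@ler_pXn2r _ 2)// ?nnegrE//.
rewrite real_normK ?num_real//.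
apply: (le_trans (sqr_wsum_le _ w0 w1)).
apply: (@le_trans _ _ (\sum_t w t * (\sum_k nu k * lr k (t i) (t j)) ^+ 2)).
  apply: ler_sum => t _; rewrite ler_wpM2l// exprMn ler_piMl ?sqr_ge0//.
  by have /andP[? ?] := T01 t; rewrite exprn_ile1.
pose Mo := \prod_(l' | (l' != i) && (l' != j)) \sum_(k < b) pois (a l') k.
have -> : \sum_t w t * (\sum_k nu k * lr k (t i) (t j)) ^+ 2 = Mo * form b.
  transitivity (\sum_k \sum_k' nu k * nu k' * expR (d k * d k' * ka) *
     \sum_t pois_box (b := b) (rate2 i j a (x k k') (y k k')) t).
    under eq_bigr do rewrite expr2 big_distrlr mulr_sumr.
    rewrite exchange_big; apply: eq_bigr => k _ /=.
    under eq_bigr do rewrite mulr_sumr.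
    rewrite exchange_big; apply: eq_bigr => k' _ /=.
    rewrite mulr_sumr; apply: eq_bigr => t _.
    rewrite /w /pois_box !(prod_rate2 a _ _ (fun c l' => pois c (t l')) ij).
    transitivity (nu k * nu k' *
      \prod_(l' | (l' != i) && (l' != j)) pois (a l') (t l') *
      (pois m (t i) * pois m2 (t j) * lr k (t i) (t j) * lr k' (t i) (t j))).
      by ring.
    by rewrite lrM; ring.
  rewrite /form mulr_sumr; apply: eq_bigr => k _.
  rewrite mulr_sumr; apply: eq_bigr => k' _.
  rewrite sum_pois_box (prod_rate2 a _ _ (fun c l' => \sum_(k < b) pois c k) ij).
  by rewrite -/Mo; ring.
have Mo01 : 0 <= Mo <= 1.
  apply/andP; split.
    by apply: prodr_ge0 => l' _; apply: sumr_ge0 => u _; exact: pois_ge0.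
  apply: prodr_ile1 => l' _; rewrite sum_pois_le1// andbT.
  by apply: sumr_ge0 => u _; exact: pois_ge0.
have form0 : 0 <= form b.
  rewrite formE; apply: sumr_ge0 => u _; apply: sumr_ge0 => v _.
  exact: sq_ge0.
have /andP[Mo0 Mo1] := Mo01.
apply: (@le_trans _ _ (form b)); first by rewrite ler_piMl.
apply: (le_trans (form_le b)).
rewrite le_eqVlt; apply/orP; left; apply/eqP.
transitivity (4 * (2^-1 ^+ q) ^+ 2 * (expR (4 * l) * expR (4 * l))); last by ring.
rewrite -expRD -exprM mulnC exprM; congr (_ * _ * expR _); last by ring.
by congr (_ ^+ _); field.
Qed.

End chi2.

(** * Exchanging the priors *)

Section hybrid.
Context {R : realType} {K : finType} {n : nat}.
Implicit Types (f : {ffun 'I_n -> K}) (g : 'I_n -> K -> R) (F : {ffun 'I_n -> K} -> R).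

Definition upd f (i : 'I_n) (k : K) : {ffun 'I_n -> K} :=
  [ffun l => if l == i then k else f l].

Definition prod_weight g f : R := \prod_i g i (f i).

Lemma sum_prod_weight g : (forall i, \sum_k g i k = 1) -> \sum_f prod_weight g f = 1.
Proof.
move=> g1; rewrite /prod_weight -(bigA_distr_bigA (fun i k => g i k)).
by rewrite big1.
Qed.

Lemma prod_weight_ge0 g f : (forall i k, 0 <= g i k) -> 0 <= prod_weight g f.
Proof. by move=> g0; apply: prodr_ge0. Qed.

(** The involution [phi] exchanges f j with an independent draw from g j: putting the weight [a] on
    coordinate j amounts to resampling it. *)
Lemma sum_resample g (a : K -> R) F (j : 'I_n) : \sum_k g j k = 1 ->
  \sum_(f : {ffun 'I_n -> K}) (\prod_(i | i != j) g i (f i)) * a (f j) * F f =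
  \sum_f prod_weight g f * \sum_k a k * F (upd f j k).
Proof.
move=> g1.
pose phi (z : {ffun 'I_n -> K} * K) := (upd z.1 j z.2, z.1 j).
have phiK : involutive phi.
  move=> [f k]; rewrite /phi /= ffunE eqxx; congr (_, _).
  by apply/ffunP => i; rewrite !ffunE; case: eqP => // ->.
transitivity (\sum_(z : {ffun 'I_n -> K} * K)
  (\prod_(i | i != j) g i (z.1 i)) * a (z.1 j) * F z.1 * g j z.2).
  rewrite -(pair_bigA _ (fun (f : {ffun 'I_n -> K}) k =>
    (\prod_(i | i != j) g i (f i)) * a (f j) * F f * g j k))/=.
  by apply: eq_bigr => f _; rewrite -mulr_sumr g1 mulr1.
rewrite (reindex_inj (can_inj phiK)) /=.
under [RHS]eq_bigr do rewrite mulr_sumr.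
rewrite pair_bigA/=; apply: eq_bigr => -[f k] _ /=.
rewrite ffunE eqxx /prod_weight [in RHS](bigD1 j)//=.
rewrite (eq_bigr (fun i => g i (f i))); first by ring.
by move=> i /negPf ij; rewrite ffunE ij.
Qed.

Variables (p : bool -> K -> R) (F : {ffun 'I_n -> K} -> R) (good : pred {ffun 'I_n -> K}).
Variables (be P : R).
Hypotheses (p0 : forall b k, 0 <= p b k) (p1 : forall b, \sum_k p b k = 1).
Hypothesis F01 : forall f, 0 <= F f <= 1.
Hypothesis be0 : 0 <= be.
Hypothesis step : forall f i, good f ->
  `|\sum_k (p false k - p true k) * F (upd f i k)| <= be.
Hypothesis bad : forall c : 'I_n -> bool,
  \sum_f prod_weight (fun i => p (c i)) f * (~~ good f)%:R <= P.

Let hyb (j : nat) (i : 'I_n) : bool := (i < j)%N.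
Let EH j : R := \sum_f prod_weight (fun i => p (hyb j i)) f * F f.

Lemma sum_absB_le2 : \sum_k `|p false k - p true k| <= 2.
Proof.
apply: (@le_trans _ _ (\sum_k (p false k + p true k))).
  apply: ler_sum => k _; apply: (le_trans (ler_normB _ _)).
  by rewrite !ger0_norm.
by rewrite big_split/= !p1.
Qed.

(** Neighbouring hybrids differ in one coordinate. On a good [f] the hypothesis [step] applies, on a
    bad one the trivial bound 2. *)
Let EH_step j : (j < n)%N -> `|EH j - EH j.+1| <= be + 2 * P.
Proof.
move=> jn; pose o := Ordinal jn.
have hs i : i != o -> hyb j.+1 i = hyb j i.
  by rewrite -val_eqE /hyb/= ltnS leq_eqVlt => /negPf ->.
have -> : EH j - EH j.+1 = \sum_f prod_weight (fun i => p (hyb j i)) f *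
    \sum_k (p false k - p true k) * F (upd f o k).
  rewrite -(sum_resample (g := fun i => p (hyb j i)))//.
  rewrite /EH -sumrB; apply: eq_bigr => f _.
  rewrite /prod_weight (bigD1 o)//= [in X in _ - X](bigD1 o)//=.
  rewrite [in X in _ - X](eq_bigr (fun i => p (hyb j i) (f i))); last first.
    by move=> i io; rewrite hs.
  by rewrite /hyb/= ltnn ltnSn; ring.
have w0 f : 0 <= prod_weight (fun i => p (hyb j i)) f by exact: prod_weight_ge0.
apply: (le_trans (ler_norm_sum _ _ _)).
apply: (@le_trans _ _ (\sum_f (prod_weight (fun i => p (hyb j i)) f * be +
    2 * (prod_weight (fun i => p (hyb j i)) f * (~~ good f)%:R)))).
  apply: ler_sum => f _; rewrite normrM (ger0_norm (w0 f)).
  rewrite mulrCA -mulrDr ler_wpM2l//.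
  have [gf|_] /= := boolP (good f).
    by rewrite mulr0 addr0 step.
  rewrite mulr1; apply: (@le_trans _ _ 2); last by rewrite lerDr.
  apply: le_trans sum_absB_le2; apply: (le_trans (ler_norm_sum _ _ _)).
  apply: ler_sum => k _; rewrite normrM ler_piMr//.
  by have /andP[? ?] := F01 (upd f o k); rewrite ger0_norm.
rewrite big_split/= -mulr_suml -mulr_sumr sum_prod_weight ?mul1r// lerD2l.
by rewrite ler_pM2l.
Qed.

Lemma hybrid_le :
  `|\sum_f prod_weight (fun=> p false) f * F f -
    \sum_f prod_weight (fun=> p true) f * F f| <= n%:R * (be + 2 * P).
Proof.
have e0 : \sum_f prod_weight (fun=> p false) f * F f = EH 0.
  by apply: eq_bigr => f _; congr (_ * _); apply: eq_bigr.
have en : \sum_f prod_weight (fun=> p true) f * F f = EH n.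
  apply: eq_bigr => f _; congr (_ * _); apply: eq_bigr => i _.
  by rewrite /hyb ltn_ord.
have H j : (j <= n)%N -> `|EH 0 - EH j| <= j%:R * (be + 2 * P).
  elim: j => [|j IH] jn; first by rewrite subrr normr0 mul0r.
  have -> : EH 0 - EH j.+1 = (EH 0 - EH j) + (EH j - EH j.+1) by ring.
  apply: (le_trans (ler_normD _ _)).
  rewrite -natr1 mulrDl mul1r; apply: lerD; [exact/IH/ltnW|exact: EH_step].
by rewrite e0 en; exact: H.
Qed.

End hybrid.

(** * An exponential tail bound for the total rate *)

Section chernoff.
Context {R : realType} {K : finType} {n : nat}.

Lemma expR_le_linear (y : R) : 0 <= y <= 1 / 2 -> expR y <= 1 + 2 * y.
Proof.
move=> /andP[y0 y1].
have h : 1 - y <= expR (- y) by exact: expR_ge1Dx.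
have e : expR y = (expR (- y))^-1 by rewrite expRN invrK.
rewrite e; have p : 0 < 1 - y by lra.
apply: (@le_trans _ _ (1 - y)^-1).
  by rewrite lef_pV2 ?posrE// expR_gt0.
rewrite -[leLHS]mul1r ler_pdivrMr//; nra.
Qed.

(** Markov's inequality for the exponential with parameter 1 / (4 m): the exponents x / (4 m) are at
    most 1/2, where exp y <= 1 + 2 y makes each factor linear in x. *)
Lemma chernoff_le (g : 'I_n -> K -> R) (x : K -> R) (m mu t : R) : 0 < m ->
  (forall i k, 0 <= g i k) -> (forall i, \sum_k g i k = 1) ->
  (forall k, 0 <= x k <= 2 * m) -> (forall i, \sum_k g i k * x k <= mu) ->
  \sum_f prod_weight g f * (~~ (\sum_i x (f i) <= t))%:R <=
  expR ((2 * (n%:R * mu) - t) / (4 * m)).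
Proof.
move=> m0 g0 g1 x0 xmu; pose th := (4 * m)^-1.
have th0 : 0 < th by rewrite invr_gt0 mulr_gt0.
apply: (@le_trans _ _ (\sum_(f : {ffun 'I_n -> K}) expR (- (t * th)) *
    \prod_i (g i (f i) * expR (x (f i) * th)))).
  apply: ler_sum => f _; rewrite big_split/= -expR_sum -/(prod_weight g f).
  rewrite mulrCA ler_wpM2l//; first exact: prod_weight_ge0.
  rewrite -mulr_suml -expRD.
  have [_|ht] := leP (\sum_i x (f i)) t; first by rewrite expR_ge0.
  apply: le_trans (expR_ge1Dx _); rewrite lerDl -mulNr -mulrDl mulr_ge0// ?ltW//.
  by rewrite addrC subr_gt0.
rewrite -mulr_sumr -(bigA_distr_bigA (fun i k => g i k * expR (x k * th))).
rewrite mulrBl expRD mulrC ler_wpM2r ?expR_ge0//.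
have -> : 2 * (n%:R * mu) / (4 * m) = \sum_(i < n) 2 * mu * th.
  by rewrite sumr_const card_ord -mulr_natl /th; ring.
rewrite expR_sum; apply: ler_prod => i _.
apply/andP; split; first by apply: sumr_ge0 => k _; rewrite mulr_ge0 ?expR_ge0.
apply: (@le_trans _ _ (\sum_k (g i k + 2 * th * (g i k * x k)))).
  apply: ler_sum => k _; rewrite (_ : g i k + _ = g i k * (1 + 2 * (x k * th))); last by ring.
  rewrite ler_wpM2l// expR_le_linear//.
  have /andP[h1 h2] := x0 k; apply/andP; split; first by rewrite mulr_ge0// ltW.
  by rewrite /th ler_pdivrMr ?mulr_gt0//; lra.
rewrite big_split/= g1 -mulr_sumr.
apply: le_trans (expR_ge1Dx _); rewrite lerD2l.
rewrite (_ : 2 * mu * th = 2 * th * mu); last by ring.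
by rewrite ler_wpM2l// mulr_ge0// ltW.
Qed.

End chernoff.

(** * From the risk to means of clipped estimators on boxes *)

Section box_mse.
Context {R : realType} {S : nat}.

Definition box_tuple (b : nat) (t : {ffun 'I_S -> 'I_b}) : S.-tuple nat :=
  [tuple (t i : nat) | i < S].

Lemma box_tuple_inj b : injective (@box_tuple b).
Proof.
move=> t u tu; apply/ffunP => i; apply: val_inj => /=.
by have := congr1 (fun z => tnth z i) tu; rewrite !tnth_mktuple.
Qed.

Lemma mse_ge_box (n b : nat) (eps : R) (p : 'I_S -> R) dhat (q : 'I_S -> R) :
  (forall i, 0 <= q i) ->
  ((\sum_(t : {ffun 'I_S -> 'I_b}) pois_box (fun i => (n%:R * q i)%R) t *
     (dhat (empirical R n (box_tuple t)) - eps_div eps p q) ^+ 2)%:E <=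
   mse n eps p dhat q)%E.
Proof.
move=> q0.
have u : uniq [seq box_tuple t | t <- enum {: {ffun 'I_S -> 'I_b}}].
  by rewrite map_inj_uniq ?enum_uniq//; exact: box_tuple_inj.
apply: le_trans (mse_ge_sum n eps p dhat q0 u).
rewrite big_map big_enum/= lee_fin le_eqVlt; apply/orP; left; apply/eqP.
apply: eq_bigr => t _; congr (_ * _); apply: eq_bigr => i _.
by rewrite tnth_mktuple.
Qed.

Lemma eps_div_itv (eps : R) (p q : 'I_S -> R) : simplex p -> (forall i, 0 <= q i) ->
  0 <= eps_div eps p q <= 1.
Proof.
move=> [p0 p1] q0; apply/andP; split.
  by apply: sumr_ge0 => i _; rewrite le_max lexx orbT.
rewrite -p1; apply: ler_sum => i _; rewrite ge_max p0 andbT gerBl.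
by rewrite mulr_ge0// expR_ge0.
Qed.

Definition clip (x : R) : R := Num.max 0 (Num.min x 1).

Lemma clip_itv x : 0 <= clip x <= 1.
Proof. by rewrite /clip le_max lexx/= ge_max ler01 ge_min lexx orbT. Qed.

Lemma clip_dist x y : 0 <= y <= 1 -> (clip x - y) ^+ 2 <= (x - y) ^+ 2.
Proof.
move=> /andP[y0 y1]; rewrite /clip; case: (leP x 1) => x1; last first.
  by rewrite max_r// -[leLHS]sqrrN -subr_ge0 subr_sqr; apply: mulr_ge0; lra.
case: (leP 0 x) => x0; first by [].
by rewrite -[leRHS]sqrrN -subr_ge0 subr_sqr; apply: mulr_ge0; lra.
Qed.

(** The bias of the clipped estimator is at most its root mean square error; the truncated mass
    costs at most [eta] because the divergence is at most 1. *)
Lemma box_expectation_close (n b : nat) (eps be eta : R) (p : 'I_S -> R) dhat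
    (q : 'I_S -> R) : simplex p -> simplex q -> 0 <= be ->
  (mse n eps p dhat q <= be%:E)%E ->
  1 - eta <= \sum_(t : {ffun 'I_S -> 'I_b}) pois_box (fun i => n%:R * q i) t ->
  `|\sum_(t : {ffun 'I_S -> 'I_b}) clip (dhat (empirical R n (box_tuple t))) *
      pois_box (fun i => n%:R * q i) t - eps_div eps p q| <= Num.sqrt be + eta.
Proof.
move=> sp [q0 q1] be0 mq mass.
set w := pois_box _ in mass *; set D := eps_div eps p q.
have D01 : 0 <= D <= 1 by apply: eps_div_itv.
have nq0 i : 0 <= n%:R * q i by rewrite mulr_ge0.
have w0 (t : {ffun 'I_S -> 'I_b}) : 0 <= w t by apply: pois_box_ge0.
have w1 : \sum_(t : {ffun 'I_S -> 'I_b}) w t <= 1 by apply: sum_pois_box_le1.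
pose T (t : {ffun 'I_S -> 'I_b}) := dhat (empirical R n (box_tuple t)).
have h1 : \sum_t w t * (T t - D) ^+ 2 <= be.
  by rewrite -lee_fin; apply: le_trans (mse_ge_box n b eps p dhat q0) mq.
have h2 : \sum_t w t * (clip (T t) - D) ^+ 2 <= be.
  apply: le_trans h1; apply: ler_sum => t _; rewrite ler_wpM2l//.
  exact: clip_dist.
have h3 : `|\sum_t w t * (clip (T t) - D)| <= Num.sqrt be.
  rewrite -sqrtr_sqr ler_sqrt//.
  exact: le_trans (sqr_wsum_le _ w0 w1) h2.
have -> : \sum_t clip (T t) * w t - D =
   \sum_t w t * (clip (T t) - D) - D * (1 - \sum_t w t).
  under [in RHS]eq_bigr do rewrite mulrBr.
  rewrite sumrB -mulr_suml; under eq_bigr do rewrite mulrC; ring.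
apply: (le_trans (ler_normB _ _)); apply: lerD => //.
have /andP[D0 D1] := D01.
rewrite ger0_norm; last by rewrite mulr_ge0// subr_ge0.
apply: (@le_trans _ _ (1 - \sum_t w t)); last by lra.
by rewrite ler_piMl// subr_ge0.
Qed.

Lemma cvg_prod_fin (I : finType) (f : I -> nat -> R) (l : I -> R) :
  (forall k, f k @ \oo --> l k) ->
  (fun n => \prod_k f k n) @ \oo --> \prod_k l k.
Proof.
move=> fl; elim: (index_enum I) => [|k s IH].
  by rewrite big_nil; under eq_fun do rewrite big_nil; exact: cvg_cst.
by rewrite big_cons; under eq_fun do rewrite big_cons; exact: cvgM.
Qed.

(** One box serves all rate vectors because [I] is finite: the sum of all the losses tends to 0. *)
Lemma exists_box (I : finType) (a : I -> 'I_S -> R) (eta : R) : 0 < eta ->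
  (forall k i, 0 <= a k i) ->
  exists b : nat, forall k,
    1 - eta <= \sum_(t : {ffun 'I_S -> 'I_b}) pois_box (a k) t.
Proof.
move=> eta0 a0.
pose u k (b : nat) := 1 - \prod_(i < S) \sum_(j < b) pois (a k i) j.
have cu : (fun b => \sum_k u k b) @ \oo --> (0 : R).
  rewrite [X in _ --> X](_ : 0 = \sum_(k : I) (1 - \prod_(i < S) (1 : R))); last first.
    by rewrite big1// => k _; rewrite big1 ?subrr.
  apply: cvg_sum_fin => k; apply: cvgB; first exact: cvg_cst.
  by apply: cvg_prod_fin => i; exact: cvg_sum_pois.
have /cvgrPdist_lt/(_ _ eta0)[b _ /(_ b (leqnn b))] := cu.
rewrite /= sub0r normrN => h; exists b => k.
rewrite sum_pois_box.
have u0 k' : 0 <= u k' b.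
  rewrite subr_ge0; apply: prodr_ile1 => i _; rewrite sum_pois_le1// andbT.
  by apply: sumr_ge0 => j _; exact: pois_ge0.
have : u k b < eta.
  apply: le_lt_trans h; rewrite ger0_norm ?sumr_ge0//.
  by rewrite (bigD1 k)//= lerDl sumr_ge0.
by rewrite /u => hu; lra.
Qed.

End box_mse.

Section cons2.
Context {R : realType} {s : nat}.

Definition special1 : 'I_s.+2 := ord0.
Definition special2 : 'I_s.+2 := lift ord0 ord0.
Definition regular (i : 'I_s) : 'I_s.+2 := lift ord0 (lift ord0 i).

Definition cons2 (a b : R) (c : 'I_s -> R) (l : 'I_s.+2) : R :=
  if unlift ord0 l is Some l' then
    if unlift ord0 l' is Some i then c i else b
  else a.

Lemma cons2_special1 a b c : cons2 a b c special1 = a.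
Proof. by rewrite /cons2 unlift_none. Qed.

Lemma cons2_special2 a b c : cons2 a b c special2 = b.
Proof. by rewrite /cons2 liftK unlift_none. Qed.

Lemma cons2_regular a b c i : cons2 a b c (regular i) = c i.
Proof. by rewrite /cons2 !liftK. Qed.

Lemma special_regular_neq i j :
  [/\ (special1 == regular i) = false, (special1 == special2) = false,
      (special2 == regular i) = false, (regular i == special2) = false &
      (regular j == regular i) = (j == i)].
Proof.
rewrite /special2 /regular !(inj_eq lift_inj) [lift _ _ == ord0]eq_sym.
by split => //; exact/negbTE/neq_lift.
Qed.

Lemma cons2_ind (Q : 'I_s.+2 -> Prop) : Q special1 -> Q special2 ->
  (forall i, Q (regular i)) -> forall l, Q l.
Proof.
move=> h1 h2 h3 l; case: (unliftP ord0 l) => [l' ->|->//].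
by case: (unliftP ord0 l') => [i ->|->//]; exact: h3.
Qed.

Lemma sum_special (f : 'I_s.+2 -> R) :
  \sum_l f l = f special1 + (f special2 + \sum_(i < s) f (regular i)).
Proof. by rewrite !big_ord_recl. Qed.

End cons2.

(** * The two fuzzy hypotheses *)

Section core.
Context {R : realType}.
Variables (s n : nat) (eps gam : R) (K : finType) (p : bool -> K -> R) (d : K -> R).
Variables (q : nat) (m r l mu : R).
(** The rate n q_i at which e^eps q_i meets p_i = gam / s. *)
Let lam0 : R := gam * n%:R * expR (- eps) / s%:R.
Hypotheses (s0 : (0 < s)%N) (n0 : (0 < n)%N).
Hypotheses (gam01 : 0 <= gam <= 1).
Hypotheses (p0 : forall b k, 0 <= p b k) (p1 : forall b, \sum_k p b k = 1).
Hypotheses (m0 : 0 < m) (r0 : 0 <= r) (rm : r <= m) (rl : r ^+ 2 <= m * l).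
Hypothesis dr : forall k, `|d k| <= r.
Hypothesis moments : forall j, (j <= q)%N ->
  \sum_k (p false k - p true k) * d k ^+ j = 0.
Hypothesis m4n : 4 * m <= n%:R.
Hypothesis mean : forall b, \sum_k p b k * (m + d k) <= mu.
Hypothesis mass : 8 * (s%:R * mu) <= n%:R.

Let n0R : 0 < n%:R :> R. Proof. by rewrite ltr0n. Qed.
Let s0R : 0 < s%:R :> R. Proof. by rewrite ltr0n. Qed.

Let x k := m + d k.
Let x_itv k : 0 <= x k <= 2 * m.
Proof.
have := dr k; rewrite ler_norml => /andP[? ?]; have := rm.
by rewrite /x => ?; apply/andP; split; lra.
Qed.

(* The first special symbol carries the mass of [P] that the regular symbols do
   not use, and no mass of [Q]; the second one absorbs the leftover mass of [Q]
   and does not contribute to the divergence. *)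
Definition core_p : 'I_s.+2 -> R := cons2 (1 - gam) 0 (fun=> gam / s%:R).

Lemma core_p_simplex : simplex core_p.
Proof.
have /andP[g0 g1] := gam01.
split.
  apply: cons2_ind => [||i]; rewrite /core_p ?cons2_special1 ?cons2_special2
    ?cons2_regular//; first by rewrite subr_ge0.
  by rewrite divr_ge0.
rewrite sum_special /core_p cons2_special1 cons2_special2 add0r.
under eq_bigr do rewrite cons2_regular.
rewrite sumr_const card_ord -[_ *+ s]mulr_natl; field.
by rewrite gt_eqF.
Qed.

Implicit Types f : {ffun 'I_s -> K}.
Let tot f : R := \sum_i x (f i).

(* The total mass of the regular symbols may exceed one on an unlikely event,
   where all the mass is moved to the second special symbol. *)
Definition core_q f : 'I_s.+2 -> R :=
  if tot f <= n%:R then cons2 0 (1 - tot f / n%:R) (fun i => x (f i) / n%:R)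
  else cons2 0 1 (fun=> 0).

Lemma core_q_simplex f : simplex (core_q f).
Proof.
rewrite /core_q; case: ifPn => h.
  split.
    apply: cons2_ind => [||i]; rewrite ?cons2_special1 ?cons2_special2 ?cons2_regular//.
      by rewrite subr_ge0 ler_pdivrMr// mul1r.
    by rewrite divr_ge0//; have /andP[] := x_itv (f i).
  rewrite sum_special cons2_special1 cons2_special2 add0r.
  under eq_bigr do rewrite cons2_regular.
  by rewrite -mulr_suml subrK.
split.
  by apply: cons2_ind => [||i]; rewrite ?cons2_special1 ?cons2_special2 ?cons2_regular.
rewrite sum_special cons2_special1 cons2_special2 add0r.
under eq_bigr do rewrite cons2_regular.
by rewrite big1// addr0.
Qed.

Let gap k : R := Num.max (lam0 - x k) 0.
(** The divergence as an affine statistic of independent draws. It stays in [0, 1] even where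
    [core_q] uses its fallback, so bad draws cost at most their probability. *)
Let dlin f : R := 1 - gam + expR eps / n%:R * \sum_i gap (f i).

Lemma core_divE f : tot f <= n%:R -> eps_div eps core_p (core_q f) = dlin f.
Proof.
have /andP[g0 g1] := gam01.
move=> h; rewrite /eps_div sum_special /core_q h /core_p.
rewrite !cons2_special1 !cons2_special2 mulr0 subr0 sub0r.
rewrite max_l ?subr_ge0// max_r; last first.
  rewrite oppr_le0 mulr_ge0 ?expR_ge0// subr_ge0 ler_pdivrMr//.
  by rewrite mul1r.
rewrite add0r /dlin mulr_sumr; congr (_ + _); apply: eq_bigr => i _.
rewrite !cons2_regular /gap.
have c0 : 0 <= expR eps / n%:R by rewrite divr_ge0// expR_ge0.
rewrite maxr_pMr// mulr0; congr (Num.max _ _).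
rewrite /lam0 expRN; field.
by rewrite !gt_eqF// expR_gt0.
Qed.

Let dlin_itv f : 0 <= dlin f <= 1.
Proof.
have /andP[g0 g1] := gam01.
have c0 : 0 <= expR eps / n%:R by rewrite divr_ge0// expR_ge0.
have lam00 : 0 <= lam0.
  by rewrite /lam0 divr_ge0// mulr_ge0 ?expR_ge0// mulr_ge0.
have S0 : 0 <= \sum_i gap (f i).
  by apply: sumr_ge0 => i _; rewrite le_max lexx orbT.
have S1 : \sum_i gap (f i) <= s%:R * lam0.
  apply: (@le_trans _ _ (\sum_(i < s) lam0)).
    apply: ler_sum => i _; rewrite ge_max lam00 andbT.
    by have /andP[? ?] := x_itv (f i); lra.
  by rewrite sumr_const card_ord -[leLHS]mulr_natl.
have h1 := mulr_ge0 c0 S0; have h2 := ler_wpM2l c0 S1.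
have e : expR eps / n%:R * (s%:R * lam0) = gam.
  by rewrite /lam0 expRN; field; rewrite !gt_eqF// expR_gt0.
by rewrite /dlin; apply/andP; split; lra.
Qed.

Let Pb : R := expR (- (n%:R / (16 * m))).

(** The threshold n / 2 instead of n leaves room to resample one symbol while the leftover symbol
    keeps a rate around which [m] units can be moved. *)
Let bad_le (c : 'I_s -> bool) :
  \sum_f prod_weight (fun i => p (c i)) f * (~~ (tot f <= n%:R / 2))%:R <= Pb.
Proof.
apply: le_trans (@chernoff_le R K s (fun i => p (c i)) x m mu (n%:R / 2) m0 _ _ x_itv _) _.
- by [].
- by [].
- by move=> i; exact: mean.
rewrite ler_expR ler_pdivrMr ?mulr_gt0//.
have -> : - (n%:R / (16 * m)) * (4 * m) = - (n%:R / 4) by field; rewrite gt_eqF.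
by have := mass; lra.
Qed.

Let expect_dlin b : \sum_f prod_weight (fun=> p b) f * dlin f =
  1 - gam + expR eps / n%:R * (s%:R * \sum_k p b k * gap k).
Proof.
rewrite /dlin; under eq_bigr do rewrite mulrDr mulrCA.
rewrite big_split/= -mulr_suml sum_prod_weight// mul1r -mulr_sumr.
congr (_ + _ * _).
under [LHS]eq_bigr do rewrite mulr_sumr.
rewrite exchange_big/= (eq_bigr (fun=> \sum_k p b k * gap k)); last first.
  move=> i _.
  have h := @sum_resample R K s (fun=> p b) (fun k => p b k * gap k) (fun=> 1) i (p1 b).
  transitivity (\sum_(f : {ffun 'I_s -> K}) prod_weight (fun=> p b) f *
      \sum_k p b k * gap k * 1).
    rewrite -h; apply: eq_bigr => f _.
    by rewrite /prod_weight (bigD1 i)//=; ring.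
  rewrite -[LHS]mulr_suml sum_prod_weight// mul1r.
  by apply: eq_bigr => k _; rewrite mulr1.
by rewrite sumr_const card_ord -[LHS]mulr_natl.
Qed.

Variables (dhat : s.+2.-tuple R -> R) (be : R).
Hypothesis be0 : 0 <= be.
Hypothesis risk : forall q', simplex q' -> (mse n eps core_p dhat q' <= be%:E)%E.

Let step_bound : R := 2 * 2^-1 ^+ q * expR (4 * l).

Let main_eta (eta : R) : 0 < eta ->
  expR eps / n%:R * (s%:R * \sum_k (p false k - p true k) * gap k) <=
  2 * (Num.sqrt be + eta + Pb) + s%:R * (step_bound + 2 * Pb).
Proof.
move=> eta0.
pose rates f i := n%:R * core_q f i.
have rates0 f i : 0 <= rates f i by rewrite mulr_ge0//; have [] := core_q_simplex f.
have [b hb] := @exists_box R s.+2 {ffun 'I_s -> K} rates eta eta0 rates0.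
pose T (t : {ffun 'I_s.+2 -> 'I_b}) := clip (dhat (empirical R n (box_tuple t))).
pose F f := \sum_t T t * pois_box (rates f) t.
have w0 f (t : {ffun 'I_s.+2 -> 'I_b}) : 0 <= pois_box (rates f) t by apply: pois_box_ge0.
have F01 f : 0 <= F f <= 1.
  apply/andP; split.
    by apply: sumr_ge0 => t _; rewrite mulr_ge0//; have /andP[] := clip_itv (dhat (empirical R n (box_tuple t))).
  apply: (@le_trans _ _ (\sum_(t : {ffun 'I_s.+2 -> 'I_b}) pois_box (rates f) t)).
    apply: ler_sum => t _; rewrite ler_piMl//.
    by have /andP[] := clip_itv (dhat (empirical R n (box_tuple t))).
  exact: sum_pois_box_le1.
have close f : `|F f - eps_div eps core_p (core_q f)| <= Num.sqrt be + eta.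
  apply: box_expectation_close => //.
  - exact: core_p_simplex.
  - exact: core_q_simplex.
  - by apply: risk; exact: core_q_simplex.
  - exact: (hb f).
have close2 f : `|F f - dlin f| <= Num.sqrt be + eta + (~~ (tot f <= n%:R / 2))%:R.
  have [h|h] := boolP (tot f <= n%:R / 2).
    rewrite /= addr0 -core_divE//; apply: le_trans h _; have := n0R; lra.
  rewrite /=; have /andP[? ?] := F01 f; have /andP[? ?] := dlin_itv f.
  have : 0 <= Num.sqrt be + eta by rewrite addr_ge0 ?sqrtr_ge0// ltW.
  by move=> ?; rewrite ler_norml; apply/andP; split; lra.
have W0 (c : 'I_s -> bool) (f : {ffun 'I_s -> K}) :
    0 <= prod_weight (fun i => p (c i)) f by apply: prod_weight_ge0.
have avg b' : `|\sum_(f : {ffun 'I_s -> K}) prod_weight (fun=> p b') f * F f -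
    \sum_f prod_weight (fun=> p b') f * dlin f| <= Num.sqrt be + eta + Pb.
  rewrite -sumrB; apply: (le_trans (ler_norm_sum _ _ _)).
  apply: (@le_trans _ _ (\sum_(f : {ffun 'I_s -> K}) (prod_weight (fun=> p b') f * (Num.sqrt be + eta) +
      prod_weight (fun=> p b') f * (~~ (tot f <= n%:R / 2))%:R))).
    apply: ler_sum => f _; rewrite -mulrBr normrM (ger0_norm (W0 (fun=> b') f)).
    by rewrite -mulrDr ler_wpM2l// (W0 (fun=> b')).
  rewrite big_split/= -mulr_suml sum_prod_weight// mul1r lerD2l.
  exact: (bad_le (fun=> b')).
have hyb := @hybrid_le R K s p F (fun f => tot f <= n%:R / 2) step_bound Pb
  p0 p1 F01 _ _ bad_le.
have sb0 : 0 <= step_bound.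
  by rewrite /step_bound mulr_ge0 ?expR_ge0// mulr_ge0// exprn_ge0.
have {}hyb : `|\sum_f prod_weight (fun=> p false) f * F f -
    \sum_f prod_weight (fun=> p true) f * F f| <= s%:R * (step_bound + 2 * Pb).
  apply: hyb => // f i good.
  (* Rate of the leftover symbol when symbol i has the central rate m; rate m + d k at i then leaves
     m2 - d k. From tot f <= n / 2 and 4 m <= n one gets m <= m2. *)
  pose m2 := n%:R - (tot f - x (f i)) - m.
  have totu k : tot (upd f i k) = tot f - x (f i) + x k.
    rewrite /tot (bigD1 i)//= [in RHS](bigD1 i)//= /upd ffunE eqxx.
    rewrite (eq_bigr (fun i => x (f i))); first by ring.
    by move=> j /negPf ji; rewrite ffunE ji.
  have /andP[xi0 xi1] := x_itv (f i).
  have totun k : tot (upd f i k) <= n%:R.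
    by rewrite totu; have /andP[? ?] := x_itv k; have := m4n; lra.
  have m2m : m <= m2 by rewrite /m2; have := m4n; lra.
  have rE k l' : rates (upd f i k) l' =
      rate2 (regular i) special2 (rates f) (m + d k) (m2 - d k) l'.
    have good' : tot f <= n%:R by apply: le_trans good _; have := n0R; lra.
    rewrite /rates /core_q totun good'; move: l'; apply: cons2_ind => [||j].
    - have [n1 n2 _ _ _] := special_regular_neq i i.
      by rewrite /rate2 n1 n2 !cons2_special1 mulr0.
    - have [_ _ n3 _ _] := special_regular_neq i i.
      by rewrite /rate2 n3 eqxx !cons2_special2 totu /m2 /x; field; rewrite gt_eqF.
    rewrite /rate2; have [_ _ _ _ ->] := special_regular_neq i j.
    have [_ _ _ -> _] := special_regular_neq j j.
    rewrite !cons2_regular; have [->|ji] := eqVneq j i.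
      by rewrite /upd ffunE eqxx -/(x k); field; rewrite gt_eqF.
    by rewrite /upd ffunE (negPf ji).
  have ne : regular i != special2.
    by have [_ _ _ -> _] := special_regular_neq i i.
  rewrite (eq_bigr (fun k => (p false k - p true k) *
    \sum_t T t * pois_box (rate2 (regular i) special2 (rates f) (m + d k) (m2 - d k)) t)).
    apply: (mixture_box_le m0 m2m r0 (sum_absB_le2 p0 p1) dr rl moments ne (rates0 f)).
    by move=> t; exact: clip_itv.
  move=> k _; congr (_ * _); apply: eq_bigr => t _; congr (_ * _).
  by apply: eq_bigr => l' _; rewrite rE.
have a1 := avg false; have a2 := avg true.
rewrite expect_dlin in a1; rewrite expect_dlin in a2.
have -> : \sum_k (p false k - p true k) * gap k =
   \sum_k p false k * gap k - \sum_k p true k * gap k.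
  by rewrite -sumrB; apply: eq_bigr => k _; rewrite mulrBl.
move: a1 a2 hyb; rewrite !ler_norml => /andP[? ?] /andP[? ?] /andP[? ?].
by rewrite !mulrBr; lra.
Qed.

Lemma core_bound :
  expR eps / n%:R * (s%:R * \sum_k (p false k - p true k) *
     Num.max (lam0 - (m + d k)) 0) <=
  2 * (Num.sqrt be + expR (- (n%:R / (16 * m)))) +
  s%:R * (2 * 2^-1 ^+ q * expR (4 * l) + 2 * expR (- (n%:R / (16 * m)))).
Proof.
apply/ler_addgt0Pr => e e0.
have e2 : 0 < e / 2 by rewrite divr_gt0.
have := main_eta e2; rewrite -/Pb -/step_bound => h.
by apply: (le_trans h); lra.
Qed.

End core.

(** * Reduction to a fixed P and estimator, and the event of an empty sample *)

Lemma minimax_risk_ge (R : realType) (S n : nat) (eps v : R) (p : 'I_S -> R) :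
  simplex p ->
  (forall dhat (be : R), 0 <= be ->
    (forall q, simplex q -> (mse n eps p dhat q <= be%:E)%E) -> v <= be) ->
  (v%:E <= minimax_risk S n eps)%E.
Proof.
move=> sp H; apply: ereal_sup_ge.
exists (ereal_inf [set ereal_sup [set mse n eps p dhat q | q in @simplex R S]
  | dhat in [set f : S.-tuple R -> R | measurable_fun setT f]]); first by exists p.
apply: le_ereal_inf_tmp => _ [dhat _ <-].
set M := ereal_sup _.
have ub q : simplex q -> (mse n eps p dhat q <= M)%E.
  by move=> sq; apply: ereal_sup_ubound; exists q.
have M0 : (0 <= M)%E.
  have [p0 _] := sp; apply: le_trans (ub _ sp).
  by have := mse_ge_sum n eps p dhat p0 (isT : uniq [::]); rewrite big_nil.
move: M0 ub; case: M => [be|_ _|]; [|by rewrite leey|by []].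
by rewrite lee_fin => be0 ub; rewrite lee_fin; exact: (H dhat be be0).
Qed.

(* Under Poisson sampling no sample at all is observed with probability
   [e^-n], whatever [Q] is. *)
Lemma minimax_risk_ge_expN (R : realType) (S n : nat) (eps : R) : (2 <= S)%N ->
  0 <= eps -> ((expR (- n%:R) / 4)%:E <= minimax_risk S n eps)%E.
Proof.
case: S => [|[|s]]// _ eps0.
pose del (j : 'I_s.+2) (i : 'I_s.+2) : R := (i == j)%:R.
have sdel j : simplex (del j).
  split; first by move=> i; rewrite /del ler0n.
  rewrite (bigD1 j)//= /del eqxx big1 ?addr0// => i /negPf -> //.
have j01 : (special2 : 'I_s.+2) != special1.
  by rewrite eq_sym neq_lift.
apply: (@minimax_risk_ge _ _ _ _ _ (del special1)); first exact: sdel.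
move=> dhat be be0 H.
pose t0 : s.+2.-tuple nat := [tuple 0%N | i < s.+2].
have mass j : \prod_(i < s.+2) pois (n%:R * del j i) (tnth t0 i) = expR (- n%:R).
  under eq_bigr do rewrite tnth_mktuple /pois expr0 fact0 divr1 mul1r.
  rewrite -expR_sum sumrN -mulr_sumr; have [_ ->] := sdel j.
  by rewrite mulr1.
have h j : expR (- n%:R) * (dhat (empirical R n t0) -
    eps_div eps (del special1) (del j)) ^+ 2 <= be.
  rewrite -lee_fin; apply: le_trans (H _ (sdel j)).
  have := @mse_ge_sum R s.+2 n eps (del special1) dhat (del j) [:: t0] (sdel j).1 isT.
  by rewrite big_seq1 mass.
have d1 : eps_div eps (del special1) (del special1) = 0.
  rewrite /eps_div big1// => i _; rewrite /del.
  have e1 : 1 <= expR eps by have := expR_ge1Dx eps; lra.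
  case: (i == special1); last by rewrite mulr0 subrr maxxx.
  by rewrite mulr1 max_r// subr_le0.
have d2 : eps_div eps (del special1) (del special2) = 1.
  rewrite /eps_div (bigD1 special1)//= /del eqxx eq_sym (negPf j01) mulr0 subr0.
  rewrite max_l ?ler0n// big1 ?addr0// => i /negPf ->; rewrite sub0r max_r//.
have h1 := h special1; have h2 := h special2.
rewrite d1 subr0 in h1; rewrite d2 in h2.
set T := dhat _ in h1 h2; set E := expR _ in h1 h2 *.
have E0 : 0 <= E := expR_ge0 _.
(* No value of the estimator at the empty sample is close to both 0 and 1. *)
have : 0 <= E * (2 * T - 1) ^+ 2 by rewrite mulr_ge0// sqr_ge0.
have -> : E * (2 * T - 1) ^+ 2 = 2 * (E * T ^+ 2) + 2 * (E * (T - 1) ^+ 2) - E by ring.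
lra.
Qed.

Lemma half_expn_le (R : realType) (q : nat) : 2^-1 ^+ q <= expR (- (q%:R / 2)) :> R.
Proof.
have -> : - (q%:R / 2) = q%:R * (- (1 / 2)) :> R by field.
rewrite expRM_natl lerXn2r ?nnegrE ?expR_ge0//.
rewrite expRN lef_pV2 ?posrE ?expR_gt0//.
have := @expR_le_linear R (1 / 2); rewrite lexx andbT divr_ge0// => /(_ isT).
lra.
Qed.

(** * Placing the grid among the Poisson rates *)

Section fuzzy_hypotheses.
Context {R : realType}.
Variables (s n q : nat) (eps gam l lam0 : R).
Hypotheses (s0 : (0 < s)%N) (n0 : (0 < n)%N) (q7 : (7 <= q)%N).
Hypotheses (eps0 : 0 <= eps) (gamE : gam = 1 / 16).
Hypothesis lam0E : lam0 = gam * n%:R * expR (- eps) / s%:R.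
Hypotheses (l1 : 1 <= l) (l4n : 4 * l <= n%:R).
Hypothesis ql : 25 * l <= lam0 * q%:R ^+ 2.
Hypothesis ql' : 24 ^+ 2 * l <= lam0 * q%:R ^+ 2.

(** The radius is r = sqrt (m l): then A^2 + B^2 = r^2 and m + A = lam0, so index 0 is the hinge.
    Having m >= l gives r <= m, hence nonnegative rates, and r^2 = m l keeps the chi-square exponent
    of order l. *)
Let m : R := Num.max lam0 l.
Let A : R := lam0 - m.
Let B : R := Num.sqrt (m * l - A ^+ 2).

Let n0R : 0 < n%:R :> R. Proof. by rewrite ltr0n. Qed.
Let s0R : 0 < s%:R :> R. Proof. by rewrite ltr0n. Qed.
Let q0R : 0 < q%:R :> R. Proof. by rewrite ltr0n (leq_trans _ q7). Qed.
Let l0 : 0 < l. Proof. exact: lt_le_trans ltr01 l1. Qed.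
Let lam0_gt0 : 0 < lam0.
Proof. by rewrite lam0E divr_gt0// mulr_gt0 ?expR_gt0// mulr_gt0//; rewrite gamE; lra. Qed.

(** For lam0 <= l the right side is lam0 (2 l - lam0); otherwise A = 0. *)
Let B2_ge : lam0 * l <= m * l - A ^+ 2.
Proof.
rewrite /A /m; have [h|h] := leP lam0 l.
  by have := lam0_gt0; nra.
by rewrite subrr expr0n subr0.
Qed.

Let B2E : B ^+ 2 = m * l - A ^+ 2.
Proof. by rewrite sqr_sqrtr// (le_trans _ B2_ge)// mulr_ge0 ?ltW. Qed.

Let B0 : 0 <= B. Proof. exact: sqrtr_ge0. Qed.

Let absA : `|A| <= l.
Proof.
rewrite /A /m; have [h|h] := leP lam0 l.
  by rewrite ler0_norm ?subr_le0//; have := lam0_gt0; lra.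
by rewrite subrr normr0 ltW.
Qed.

Let A_small (M : R) : 0 <= M -> M * l <= lam0 * q%:R ^+ 2 ->
  M * A ^+ 2 <= lam0 * l * q%:R ^+ 2.
Proof.
move=> M0 Ml; apply: (@le_trans _ _ (M * l * l)); last by rewrite [leRHS]mulrAC ler_wpM2r// ltW.
rewrite -mulrA ler_wpM2l// -real_normK ?num_real// expr2.
by apply: ler_pM.
Qed.

Let AB : `|A| <= B * (q%:R / 5).
Proof.
have rhs0 : 0 <= B * (q%:R / 5) by rewrite mulr_ge0// divr_ge0// ltW.
rewrite -(@ler_pXn2r _ 2)// ?nnegrE// real_normK ?num_real//.
have -> : (B * (q%:R / 5)) ^+ 2 = B ^+ 2 * q%:R ^+ 2 / 25 by field.
rewrite B2E ler_pdivlMr// mulrC.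
apply: (le_trans (A_small _ ql)) => //.
by rewrite ler_wpM2r// sqr_ge0.
Qed.

Let m0 : 0 < m. Proof. by rewrite lt_max l0 orbT. Qed.
Let lm : l <= m. Proof. by rewrite le_max lexx orbT. Qed.

Let e1 : expR (- eps) <= 1.
Proof. by rewrite expR_le1 oppr_le0. Qed.

Let slam0 : s%:R * lam0 <= gam * n%:R.
Proof.
have -> : s%:R * lam0 = gam * n%:R * expR (- eps).
  by rewrite lam0E; field; rewrite gt_eqF.
by rewrite ler_piMr// mulr_ge0 ?ltW// gamE; lra.
Qed.

Let lam0_le : lam0 <= gam * n%:R.
Proof.
apply: le_trans slam0; rewrite ler_peMl ?ler1n//; exact: ltW lam0_gt0.
Qed.

Let y k := grid_pt q A B k.

Let y_le k : `|y k| <= Num.sqrt (m * l).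
Proof.
rewrite -sqrtr_sqr ler_sqrt; last by rewrite mulr_ge0// ltW.
have -> : m * l = (A ^+ 2 + B ^+ 2) * (cos (grid_angle q k) ^+ 2 + sin (grid_angle q k) ^+ 2).
  by rewrite cos2Dsin2 mulr1 B2E; ring.
rewrite /y /grid_pt -subr_ge0.
set c := cos _; set t := sin _.
have -> : (A ^+ 2 + B ^+ 2) * (c ^+ 2 + t ^+ 2) - (A * c - B * t) ^+ 2 =
  (A * t + B * c) ^+ 2 by ring.
exact: sqr_ge0.
Qed.

Let mean b : \sum_(k < 6 * q) prior q b k * (m + y k) <= 2 * lam0.
Proof.
have -> : \sum_(k < 6 * q) prior q b k * (m + y k) =
    m * (\sum_(k < 6 * q) prior q b k) + \sum_(k < 6 * q) prior q b k * y k.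
  by rewrite mulr_sumr -big_split/=; apply: eq_bigr => k _; rewrite mulrDr mulrC.
rewrite (sum_prior q7 A B) mulr1.
have h : \sum_(k < 6 * q) prior q b k * y k <= A + `|A| * (24 ^+ 2 / q%:R ^+ 2).
  exact: prior_mean q7 A B b.
have AE : A = lam0 - m by [].
have h2 : `|A| * (24 ^+ 2 / q%:R ^+ 2) <= lam0.
  rewrite mulrA ler_pdivrMr ?exprn_gt0// mulrC.
  by apply: le_trans ql'; rewrite ler_wpM2l.
move: h; rewrite {1}AE; lra.
Qed.

Variables (dhat : s.+2.-tuple R -> R) (be : R).
Hypothesis be0 : 0 <= be.
Hypothesis risk : forall q', simplex q' -> (mse n eps (core_p (s := s) gam) dhat q' <= be%:E)%E.

Let Pb : R := expR (- (n%:R / (16 * m))).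

Lemma risk_separation :
  expR eps * s%:R / n%:R * (Num.sqrt (lam0 * l) / (10 * 72 ^+ 2 * q%:R)) <=
  2 * (Num.sqrt be + Pb) + s%:R * (2 * expR (- (q%:R / 2)) * expR (4 * l) + 2 * Pb).
Proof.
have mr : Num.sqrt (m * l) <= m.
  rewrite -[leRHS](ger0_norm (ltW m0)) -sqrtr_sqr ler_sqrt ?sqr_ge0//.
  by rewrite expr2 ler_wpM2l// ltW.
have rl : Num.sqrt (m * l) ^+ 2 <= m * l by rewrite sqr_sqrtr// mulr_ge0// ltW.
have gam01 : 0 <= gam <= 1 by rewrite gamE; apply/andP; split; lra.
have m4n : 4 * m <= n%:R.
  rewrite /m; have := lam0_le; rewrite gamE => h.
  by have [_|_] := leP lam0 l; first exact: l4n; have := n0R; lra.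
(* This fixes gam = 1 / 16, as 8 * 2 * gam = 1. *)
have mass : 8 * (s%:R * (2 * lam0)) <= n%:R by have := slam0; rewrite gamE; lra.
have core := @core_bound R s n eps gam 'I_(6 * q) (fun b k => prior q b k)
  (fun k => y k) q m (Num.sqrt (m * l)) l (2 * lam0) s0 n0 gam01
  (fun b k => prior_ge0 q7 b k) (fun b => sum_prior q7 A B b) m0 (sqrtr_ge0 _) mr rl
  (fun k => y_le k) (prior_moment q7 A B) m4n mean mass dhat be be0 risk.
rewrite -lam0E -/Pb in core.
apply: (@le_trans _ _ (expR eps / n%:R * (s%:R * \sum_(k < 6 * q)
  (prior q false k - prior q true k) * Num.max (lam0 - (m + y k)) 0))); last first.
  apply: (le_trans core); rewrite lerD2l ler_wpM2l// lerD2r.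
  by rewrite ler_wpM2r ?expR_ge0// ler_wpM2l// half_expn_le.
rewrite [leRHS]mulrA [expR eps / n%:R * s%:R]mulrAC ler_wpM2l//.
under eq_bigr do rewrite opprD addrA -/A.
apply: le_trans (prior_gap q7 B0 AB).
rewrite ler_wpM2r ?invr_ge0 ?mulr_ge0 ?exprn_ge0 ?(ltW q0R)//.
rewrite /B ler_sqrt//.
by apply: le_trans B2_ge; rewrite mulr_ge0// ltW.
Qed.

End fuzzy_hypotheses.

(** * Choice of the constants *)

Lemma expR_growth (R : realType) (c C l S : R) : 0 < c -> 0 < C -> S = expR l ->
  7 <= l -> 16 * 24 * (C + 4) / c <= l -> 48 * (C + 4) <= l -> 24 / c ^+ 2 <= l ->
  [/\ 16 * (C + 4) * l ^+ 3 <= c * S, (C + 4) * l <= S / 2 & l ^+ 2 <= c ^+ 2 * S].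
Proof.
move=> c0 C0 SE l7 h1 h2 h3.
have l0 : 0 < l by lra.
have S4 : l ^+ 4 / 24 <= S.
  have := @expR_ge1Dxn R l 3 (ltW l0); rewrite -SE.
  by rewrite (_ : 4`!%:R = 24 :> R)//; lra.
have l3 : 0 < l ^+ 3 by rewrite exprn_gt0.
have l2 : 0 < l ^+ 2 by rewrite exprn_gt0.
have e4 : l ^+ 4 = l * l ^+ 3 by ring.
rewrite ler_pdivrMr// in h1; rewrite ler_pdivrMr ?exprn_gt0// in h3.
split.
- apply: (@le_trans _ _ (c * (l ^+ 4 / 24))); last by rewrite ler_pM2l.
  have := ler_wpM2r (ltW l3) h1; rewrite e4; lra.
- apply: (@le_trans _ _ (l ^+ 4 / 24 / 2)); last by lra.
  have h4 : 48 * (C + 4) * l <= l * l by rewrite ler_wpM2r// ltW.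
  have h5 : l * l <= l ^+ 4.
    by rewrite (_ : l * l = l ^+ 2)// ler_weXn2l//; lra.
  lra.
apply: (@le_trans _ _ (c ^+ 2 * (l ^+ 4 / 24))); last by rewrite ler_wpM2l// sqr_ge0.
have h4 : 24 * l ^+ 2 <= l * c ^+ 2 * l ^+ 2 by rewrite ler_wpM2r// ltW.
have h5 : l * c ^+ 2 * l ^+ 2 <= c ^+ 2 * l ^+ 4.
  rewrite (_ : c ^+ 2 * l ^+ 4 = l * c ^+ 2 * l ^+ 2 * l); last by ring.
  by rewrite ler_peMr ?mulr_ge0 ?sqr_ge0 ?(ltW l0)//; lra.
lra.
Qed.

(** There are at most S = exp l exchanges, and q >= 2 (C + 8) l brings exp (- q / 2 + 4 l) down to
    exp (- (C + 4) l), the size allowed for [P]. *)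
Lemma exchange_error_le (R : realType) (C l s S q P : R) : 0 < l -> S = expR l ->
  0 <= s -> s <= S -> 0 <= P -> P <= expR (- ((C + 4) * l)) ->
  2 * (C + 8) * l <= q ->
  2 * P + s * (2 * expR (- (q / 2)) * expR (4 * l) + 2 * P) <=
  6 * expR (- ((C + 3) * l)).
Proof.
move=> l0 SE s0 sS P0 PC qC; set X := expR (- ((C + 3) * l)).
have P_le : S * P <= X.
  apply: (@le_trans _ _ (expR l * expR (- ((C + 4) * l)))).
    by rewrite SE ler_pM2l ?expR_gt0.
  by rewrite -expRD /X ler_expR; lra.
have S1 : 1 <= S by rewrite SE; have := expR_ge1Dx l; lra.
have h1 : P <= X by apply: le_trans P_le; rewrite ler_peMl.
have h2 : s * P <= X by apply: le_trans P_le; rewrite ler_wpM2r.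
have h3 : s * (expR (- (q / 2)) * expR (4 * l)) <= X.
  apply: (@le_trans _ _ (expR l * (expR (- (q / 2)) * expR (4 * l)))).
    by rewrite ler_wpM2r -?SE// mulr_ge0// expR_ge0.
  by rewrite -!expRD /X ler_expR; lra.
lra.
Qed.

(** The rate is at least 1 / n >= exp (- C l), far above the squared error. The 12 is twice the 6 of
    [exchange_error_le], so that errors use up at most half of the separation. *)
Lemma exp_negligible (R : realType) (C l e S n k : R) : 0 < C -> 0 < l -> 0 < n ->
  0 < k -> 1 <= e -> l <= S -> ln n <= C * l -> 24 <= l * k ->
  (12 * expR (- ((C + 3) * l))) ^+ 2 <= k * (e * S / (n * l)).
Proof.
move=> C0 l0 n0 k0 e1 lS nC kl; set X := expR (- ((C + 3) * l)).
have S0 : 0 < S by apply: lt_le_trans lS.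
have nexp : n <= expR (C * l) by rewrite -[leLHS]lnK ?posrE// ler_expR.
apply: (@le_trans _ _ (k * expR (- (C * l)))); last first.
  rewrite ler_pM2l// expRN.
  apply: (@le_trans _ _ n^-1); first by rewrite lef_pV2 ?posrE ?expR_gt0.
  rewrite ler_pdivlMr ?mulr_gt0// mulrA mulVf ?gt_eqF// mul1r.
  by apply: (le_trans lS); rewrite ler_peMl ?(ltW S0).
have X2 : X ^+ 2 <= expR (- (C * l)) * expR (- (6 * l)).
  by rewrite /X -expRM_natl -expRD ler_expR; have := mulr_gt0 C0 l0; lra.
have e6 : expR (- (6 * l)) <= (6 * l)^-1.
  rewrite expRN lef_pV2 ?posrE ?expR_gt0 ?mulr_gt0//.
  by have := expR_ge1Dx (6 * l); lra.
have k6 : 12 ^+ 2 * (6 * l)^-1 <= k.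
  by rewrite ler_pdivrMr ?mulr_gt0//; lra.
have E0 : 0 <= expR (- (C * l)) := expR_ge0 _.
rewrite exprMn; apply: (le_trans (ler_wpM2l (sqr_ge0 _) X2)).
rewrite mulrCA [leRHS]mulrC ler_wpM2l//.
by apply: le_trans k6; rewrite ler_wpM2l// sqr_ge0.
Qed.

(** The order of the final bound: (e s / n)^2 lam0 l / q^2 with lam0 = gam n / (e s) and q of order
    l is a multiple of e s / (n l). *)
Lemma sqr_separation_ge (R : realType) (e s S n l K gam q lam0 : R) : 0 < e -> 0 < s ->
  S / 2 <= s -> 0 < n -> 0 < l -> 0 < K -> 0 < gam -> 0 < q -> q <= 2 * (K * l) ->
  0 <= S -> lam0 = gam * n * e^-1 / s ->
  gam / (8 * (10 * 72 ^+ 2) ^+ 2 * K ^+ 2) * (e * S / (n * l)) <=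
  (e * s / n * (Num.sqrt (lam0 * l) / (10 * 72 ^+ 2 * q))) ^+ 2.
Proof.
move=> e0 s0 Ss n0 l0 K0 g0 q0 qKl S0 lamE.
set V := leLHS; set G := _ * (_ / _).
have lam0_ge0 : 0 <= lam0 * l.
  by rewrite lamE !mulr_ge0// ?invr_ge0 ltW.
have -> : G ^+ 2 = gam * (e * s * l / (n * (10 * 72 ^+ 2) ^+ 2)) / q ^+ 2.
  transitivity ((e * s / n) ^+ 2 * Num.sqrt (lam0 * l) ^+ 2 /
      (10 * 72 ^+ 2 * q) ^+ 2); first by rewrite /G; field; rewrite !gt_eqF.
  by rewrite sqr_sqrtr// lamE; field; rewrite !gt_eqF.
rewrite ler_pdivlMr ?exprn_gt0//.
have q2l : q ^+ 2 <= (2 * (K * l)) ^+ 2.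
  by rewrite lerXn2r// nnegrE ?(ltW q0)// !mulr_ge0// ltW.
have V0 : 0 <= V.
  apply: mulr_ge0.
    apply: divr_ge0; first exact: ltW.
    by apply: mulr_ge0; [apply: mulr_ge0 => //|]; exact: sqr_ge0.
  by rewrite divr_ge0// mulr_ge0 ?(ltW e0) ?(ltW n0) ?(ltW l0).
apply: (le_trans (ler_wpM2l V0 q2l)).
have -> : V * (2 * (K * l)) ^+ 2 = gam * (e * (S / 2) * l / (n * (10 * 72 ^+ 2) ^+ 2)).
  by rewrite /V; field; rewrite !gt_eqF.
apply: ler_wpM2l; first exact: ltW.
apply: ler_wpM2r; first by rewrite invr_ge0 mulr_ge0 ?sqr_ge0 ?(ltW n0).
by rewrite ler_wpM2r ?(ltW l0)// ler_wpM2l ?(ltW e0).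
Qed.

Lemma chernoff_exponent_ge (R : realType) (C l n s gam lam0 m : R) : 0 < C -> 0 < l ->
  0 < lam0 -> gam = 1 / 16 -> 0 <= n -> lam0 * s <= gam * n -> (C + 4) * l <= s ->
  16 * (C + 4) * l ^+ 2 <= n -> m = Num.max lam0 l -> (C + 4) * l <= n / (16 * m).
Proof.
move=> C0 l0 lam00 -> n0 lam0n ls nl16 ->.
rewrite ler_pdivlMr; last by rewrite mulr_gt0// lt_max l0 orbT.
have [_|_] := leP lam0 l; first by rewrite expr2 in nl16; lra.
have h : lam0 * ((C + 4) * l) <= 1 / 16 * n.
  by apply: le_trans lam0n; rewrite ler_pM2l.
lra.
Qed.

(** * Large and small alphabets *)

Section large.
Context {R : realType}.
Variables (c C : R).
Hypotheses (c_gt0 : 0 < c) (C_gt0 : 0 < C).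

(** The degree q is about K l. The term 96 ^ 2 / c ensures lam0 q^2 >= 24 ^ 2 l even for lam0 = c /
    (16 l), as 96 ^ 2 / 16 = 24 ^ 2; the term 2 (C + 8) serves [exchange_error_le]. *)
Definition degree_ratio : R := 1 + 96 ^+ 2 / c + 2 * (C + 8).
Local Notation K := degree_ratio.

Definition risk_constant : R := 1 / 16 / (8 * (10 * 72 ^+ 2) ^+ 2 * K ^+ 2).
Local Notation k1 := risk_constant.

Definition log_threshold : R :=
  7 + 16 * 24 * (C + 4) / c + 48 * (C + 4) + 24 / c ^+ 2 + 24 / k1.

Lemma degree_ratio_ge : [/\ 1 <= K, 24 ^+ 2 <= K * (1 / 16 * c) & 2 * (C + 8) <= K].
Proof.
have h : 0 < 96 ^+ 2 / c by rewrite divr_gt0// exprn_gt0.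
have h2 : 24 ^+ 2 = 96 ^+ 2 / c * (1 / 16 * c) by field; rewrite gt_eqF.
split; rewrite /degree_ratio; [have := C_gt0; lra| |lra].
by rewrite {1}h2 ler_wpM2r//; have := c_gt0; have := C_gt0; lra.
Qed.

Let K0 : 0 < K.
Proof. by have [h _ _] := degree_ratio_ge; lra. Qed.

Lemma risk_constant_gt0 : 0 < k1.
Proof. by rewrite /risk_constant divr_gt0// !mulr_gt0// exprn_gt0// mulr_gt0// exprn_gt0. Qed.

Lemma log_threshold_ge l : log_threshold <= l ->
  [/\ 7 <= l, 16 * 24 * (C + 4) / c <= l, 48 * (C + 4) <= l, 24 / c ^+ 2 <= l & 24 / k1 <= l].
Proof.
rewrite /log_threshold => h.
have h1 : 0 <= 16 * 24 * (C + 4) / c by rewrite divr_ge0 ?mulr_ge0 ?ltW// addr_gt0.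
have h2 : 0 <= 24 / c ^+ 2 by rewrite divr_ge0// sqr_ge0.
have h3 : 0 <= 24 / k1 by rewrite divr_ge0// ltW// risk_constant_gt0.
by have := C_gt0; split; lra.
Qed.

Lemma minimax_risk_large (eps : R) (S n : nat) (l := ln (S%:R : R)) :
  0 <= eps -> (2 <= S)%N -> (2 <= n)%N ->
  c * (expR eps * S%:R / l) <= n%:R -> ln (n%:R : R) <= C * l ->
  log_threshold <= l ->
  ((k1 / 16 * (expR eps * S%:R / (n%:R * l)))%:E <= minimax_risk S n eps)%E /\
  l <= 2 * ln (n%:R : R).
Proof.
move=> eps0 S2 n2 nS nC lbig.
have [l7 b1 b2 b3 b4] := log_threshold_ge lbig.
have [K1 Kc KC] := degree_ratio_ge.
have c0 := c_gt0; have C0 := C_gt0; have k0 := risk_constant_gt0.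
have l0 : 0 < l by lra.
have S0 : 0 < S%:R :> R by rewrite ltr0n ltnW.
have n0 : 0 < n%:R :> R by rewrite ltr0n ltnW.
have SE : S%:R = expR l by rewrite /l lnK// posrE.
have [g1 g2 g3] := expR_growth c0 C0 SE l7 b1 b2 b3.
have e1 : 1 <= expR eps by have := expR_ge1Dx eps; lra.
have Sl : l + 1 <= S%:R by rewrite SE addrC expR_ge1Dx.
have cSn : c * S%:R <= n%:R * l.
  rewrite mulrA ler_pdivrMr// in nS; apply: le_trans nS.
  rewrite ler_pM2l//; nra.
have nl16 : 16 * (C + 4) * l ^+ 2 <= n%:R.
  rewrite -(ler_pM2r l0); apply: le_trans cSn.
  by rewrite (_ : 16 * (C + 4) * l ^+ 2 * l = 16 * (C + 4) * l ^+ 3)//; ring.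
split; last first.
  (* From c S <= n l and l^2 <= c^2 S. It allows ln n to replace ln S in the rate. *)
  have Sn2 : S%:R <= n%:R ^+ 2 :> R.
    rewrite -(ler_pM2r (exprn_gt0 2 l0)) -[leRHS]exprMn.
    apply: (@le_trans _ _ ((c * S%:R) ^+ 2)).
      by have := ler_wpM2l (ltW S0) g3; rewrite exprMn; lra.
    have cS0 : 0 <= c * S%:R by rewrite mulr_ge0// ltW.
    have nl0 : 0 <= n%:R * l by rewrite mulr_ge0// ltW.
    by rewrite lerXn2r.
  by rewrite mulrC mulr_natr -lnXn// /l ler_ln ?posrE ?exprn_gt0.
case: S S2 @l nS nC lbig l7 b1 b2 b3 b4 l0 S0 SE g1 g2 g3 Sl cSn nl16 => [|[|s]]// _ l.
move=> nS nC lbig l7 b1 b2 b3 b4 l0 S0 SE g1 g2 g3 Sl cSn nl16.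
clear lbig b1 b2 b3 g3 cSn.
have S2R : s.+2%:R = s%:R + 2 :> R by rewrite -addn2 natrD.
have s2 : s.+2%:R / 2 <= s%:R :> R by rewrite S2R; lra.
have s0R : 0 < s%:R :> R by lra.
have s0 : (0 < s)%N by rewrite -(ltr0n R).
have n0' : (0 < n)%N by exact: ltnW.
pose gam : R := 1 / 16.
have gam01 : 0 <= gam <= 1 by rewrite /gam; apply/andP; split; lra.
pose lam0 := gam * n%:R * expR (- eps) / s%:R.
pose q := (Num.truncn (K * l)).+1.
have Kl0 : 0 <= K * l by rewrite mulr_ge0 ?ltW.
have /andP[q1 q2] := truncn_itv Kl0.
have Klq : K * l <= q%:R by rewrite ltW.
have Kl7 : 7 <= K * l by rewrite -[7]mul1r ler_pM.
have qKl : q%:R <= 2 * (K * l) by rewrite /q -natr1; lra.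
have q7 : (7 <= q)%N by rewrite -(ler_nat R) (le_trans Kl7).
have q0 : 0 < q%:R :> R by rewrite ltr0n.
have sS : s%:R <= s.+2%:R :> R by rewrite S2R; lra.
have lam0_ge : gam * c / l <= lam0.
  rewrite /lam0 ler_pdivlMr// expRN.
  rewrite ler_pdivlMr ?expR_gt0//.
  apply: (@le_trans _ _ (gam * (c * (expR eps * s.+2%:R / l)))); last first.
    by rewrite ler_pM2l// /gam; lra.
  have -> : gam * c / l * s%:R * expR eps = gam * (c * (expR eps * s%:R / l)).
    by field; rewrite gt_eqF.
  rewrite ler_pM2l; last by rewrite /gam; lra.
  by rewrite ler_pM2l// ler_pM2r ?invr_gt0// ler_pM2l ?expR_gt0.
have ql' : 24 ^+ 2 * l <= lam0 * q%:R ^+ 2.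
  have h1 : (K * l) ^+ 2 <= q%:R ^+ 2 by rewrite lerXn2r// nnegrE.
  have h2 : gam * c / l * (K * l) ^+ 2 <= lam0 * q%:R ^+ 2.
    apply: ler_pM => //; last exact: sqr_ge0.
    by rewrite divr_ge0 ?ltW// mulr_gt0// /gam; lra.
  apply: le_trans h2.
  have -> : gam * c / l * (K * l) ^+ 2 = K * (gam * c) * K * l.
    by field; rewrite gt_eqF.
  rewrite ler_pM2r//; apply: (le_trans Kc).
  by rewrite ler_peMr// mulr_ge0 ?ltW// mulr_gt0.
have ql : 25 * l <= lam0 * q%:R ^+ 2 by apply: le_trans ql'; lra.
have l4n : 4 * l <= n%:R.
  apply: le_trans nl16; rewrite expr2; nra.
apply: (minimax_risk_ge (core_p_simplex s0 gam01)) => dhat be be0 risk.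
have l1 : 1 <= l by lra.
have sep := risk_separation s0 n0' q7 eps0 (erefl gam : gam = 1 / 16)
  (erefl lam0 : lam0 = _) l1 l4n ql ql' be0 risk.
set m := Num.max lam0 l in sep.
have lam00 : 0 < lam0.
  by apply: lt_le_trans lam0_ge; rewrite divr_gt0// mulr_gt0// /gam; lra.
have lam0n : lam0 * s%:R <= gam * n%:R.
  rewrite /lam0 divfK ?gt_eqF// ler_piMr ?expR_le1 ?oppr_le0//.
  by rewrite mulr_ge0 ?(ltW n0)//; have /andP[] := gam01.
have Pb : expR (- (n%:R / (16 * m))) <= expR (- ((C + 4) * l)).
  rewrite ler_expR lerN2.
  exact: (chernoff_exponent_ge C0 l0 lam00 (erefl gam) (ltW n0) lam0n
    (le_trans g2 s2) nl16 (erefl m)).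
set P := expR (- (n%:R / (16 * m))) in sep Pb.
pose V := k1 * (expR eps * s.+2%:R / (n%:R * l)).
have KlC : 2 * (C + 8) * l <= q%:R by apply: le_trans Klq; rewrite ler_pM2r.
have err := exchange_error_le l0 SE (ltW s0R) sS (expR_ge0 _) Pb KlC.
rewrite -/P in err.
set X := expR (- ((C + 3) * l)) in err.
set G := expR eps * s%:R / n%:R * _ in sep.
have G0 : 0 <= G.
  by apply: mulr_ge0; apply: divr_ge0; rewrite ?sqrtr_ge0 ?mulr_ge0 ?expR_ge0
    ?exprn_ge0 ?ler0n.
have g0 : 0 < gam by rewrite divr_gt0.
have VG : V <= G ^+ 2.
  by apply: sqr_separation_ge; rewrite ?expR_gt0// /lam0 expRN.
have kl24 : 24 <= l * k1 by rewrite -ler_pdivrMr.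
have XV : (12 * X) ^+ 2 <= V.
  by apply: exp_negligible => //; apply: le_trans Sl; rewrite lerDl.
have X12 : 12 * X <= G.
  have X0 : 0 <= 12 * X by rewrite mulr_ge0// expR_ge0.
  rewrite -(@ler_pXn2r _ 2)//; exact: le_trans XV VG.
(* Indeed 2 sqrt be >= G - 6 X >= G / 2. *)
have sb : G / 4 <= Num.sqrt be by clear -sep err X12; lra.
have : (G / 4) ^+ 2 <= be.
  rewrite -[leRHS](sqr_sqrtr be0) lerXn2r// nnegrE ?sqrtr_ge0//.
  by rewrite divr_ge0.
rewrite expr_div_n => hb.
rewrite mulrAC -/V; apply: le_trans hb.
rewrite (_ : 4 ^+ 2 = 16); last by ring.
by rewrite ler_wpM2r// invr_ge0.
Qed.

(** Here n <= exp (C L) bounds exp (- n) from below, while the assumption on n bounds the rate by L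
    / (c ln 2). *)
Lemma minimax_risk_small (eps : R) (S n : nat) (l := ln (S%:R : R)) (L : R) :
  0 <= eps -> (2 <= S)%N -> (2 <= n)%N ->
  c * (expR eps * S%:R / l) <= n%:R -> ln (n%:R : R) <= C * l -> l <= L ->
  ((expR (- expR (C * L)) / 4 * (c * ln 2 / L) *
     (expR eps * S%:R / (n%:R * ln (n%:R : R))))%:E <= minimax_risk S n eps)%E.
Proof.
move=> eps0 S2 n2 nS nC lL.
apply: le_trans (minimax_risk_ge_expN n S2 eps0); rewrite lee_fin.
have S0 : 0 < S%:R :> R by rewrite ltr0n ltnW.
have n0 : 0 < n%:R :> R by rewrite ltr0n ltnW.
have l0 : 0 < l by rewrite ln_gt0// ltr1n.
have L0 : 0 < L by apply: lt_le_trans lL.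
have ln20 : 0 < ln 2 :> R by rewrite ln_gt0// ltr1n.
have ln2n : ln 2 <= ln (n%:R : R) by rewrite ler_ln ?posrE// ler_nat.
have lnn0 : 0 < ln (n%:R : R) by apply: lt_le_trans ln2n.
have c0 := c_gt0; have C0 := C_gt0.
have nexp : n%:R <= expR (C * L).
  rewrite -[leLHS]lnK ?posrE// ler_expR; apply: (le_trans nC).
  by rewrite ler_pM2l.
have E : expR (- expR (C * L)) <= expR (- n%:R) :> R by rewrite ler_expR lerN2.
have h : c * ln 2 / L * (expR eps * S%:R / (n%:R * ln (n%:R : R))) <= 1.
  have -> : c * ln 2 / L * (expR eps * S%:R / (n%:R * ln (n%:R : R))) =
     (c * (expR eps * S%:R / l) / n%:R) * (ln 2 / ln (n%:R : R)) * (l / L).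
    by field; rewrite !gt_eqF.
  rewrite -[leRHS]mulr1 -[X in _ <= X * _]mulr1.
  have eS : 0 <= expR eps * S%:R by rewrite mulr_ge0// expR_ge0.
  apply: ler_pM; [|by rewrite divr_ge0 ?ltW| |by rewrite ler_pdivrMr// mul1r].
    by rewrite mulr_ge0// divr_ge0 ?ltW// mulr_gt0// divr_gt0// mulr_gt0// expR_gt0.
  apply: ler_pM; [|by rewrite divr_ge0 ?ltW|by rewrite ler_pdivrMr// mul1r
    |by rewrite ler_pdivrMr// mul1r].
  by rewrite divr_ge0 ?(ltW n0)// mulr_ge0 ?(ltW c0)// divr_ge0 ?(ltW l0).
rewrite -mulrA.
apply: (@le_trans _ _ (expR (- expR (C * L)) / 4)).
  by rewrite ler_piMr// divr_ge0// expR_ge0.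
by rewrite ler_pM2r// invr_gt0.
Qed.

End large.

Theorem corollary6 (R : realType) (c C : R) (c_gt0 : 0 < c) (C_gt0 : 0 < C) :
  exists a : R, 0 < a /\
    forall (eps : R) (S n : nat),
      0 <= eps -> (2 <= S)%N -> (2 <= n)%N ->
      c * (expR eps * S%:R / ln (S%:R : R)) <= n%:R ->
      ln (n%:R : R) <= C * ln (S%:R : R) ->
      ((a * (expR eps * S%:R / (n%:R * ln (n%:R : R))))%:E
         <= minimax_risk S n eps)%E.
Proof.
pose L := log_threshold c C.
have L0 : 0 < L by have [h _ _ _ _] := log_threshold_ge c_gt0 C_gt0 (lexx L); lra.
have k0 := risk_constant_gt0 c_gt0 C_gt0.
(* The 32 is the 16 of [minimax_risk_large] times the 2 of ln S <= 2 ln n. *)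
pose a1 := risk_constant c C / 32.
pose a2 := expR (- expR (C * L)) / 4 * (c * ln 2 / L).
have ln20 : 0 < ln 2 :> R by rewrite ln_gt0// ltr1n.
have a10 : 0 < a1 by rewrite divr_gt0.
have a20 : 0 < a2 by rewrite mulr_gt0// divr_gt0 ?expR_gt0// mulr_gt0.
exists (Num.min a1 a2); split; first by rewrite lt_min a10.
move=> eps S n eps0 S2 n2 nS nC.
have n0 : 0 < n%:R :> R by rewrite ltr0n ltnW.
have S0 : 0 < S%:R :> R by rewrite ltr0n ltnW.
have lnn0 : 0 < ln (n%:R : R) by rewrite ln_gt0// ltr1n.
have l0 : 0 < ln (S%:R : R) by rewrite ln_gt0// ltr1n.
have rate0 : 0 <= expR eps * S%:R / (n%:R * ln (n%:R : R)).
  by rewrite divr_ge0// mulr_ge0 ?expR_ge0// ltW.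
have [lL|Ll] := leP (ln (S%:R : R)) L.
  apply: le_trans (minimax_risk_small c_gt0 C_gt0 eps0 S2 n2 nS nC lL).
  by rewrite lee_fin ler_wpM2r// ge_min lexx orbT.
have [h l2] := minimax_risk_large c_gt0 C_gt0 eps0 S2 n2 nS nC (ltW Ll).
apply: le_trans h; rewrite lee_fin.
apply: (@le_trans _ _ (a1 * (expR eps * S%:R / (n%:R * ln (n%:R : R))))).
  by rewrite ler_wpM2r// ge_min lexx.
have -> : a1 * (expR eps * S%:R / (n%:R * ln (n%:R : R))) =
    risk_constant c C / 16 * (expR eps * S%:R / (n%:R * (2 * ln (n%:R : R)))).
  by rewrite /a1; field; rewrite !gt_eqF.
apply: ler_wpM2l; first by rewrite divr_ge0// ltW.
apply: ler_wpM2l; first by rewrite mulr_ge0 ?expR_ge0 ?(ltW S0).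
by rewrite lef_pV2 ?posrE ?mulr_gt0// ler_pM2l.
Qed.
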